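(* Let $n\ge 1$ and $0\le k,m\le n$ be integers, and let $\lambda$ be a partition with at most $k$ parts not exceeding $n-k$ and $\mu$ a partition with at most $m$ parts not exceeding $n-m$. Then the partial order on $\mathcal I_n(\lambda,\mu)$ given by inclusion of $B$-orbit closures in $\mathrm{Gr}(k,n)\times\mathrm{Gr}(m,n)$ is the restriction to $\mathcal I_n(\lambda,\mu)$ of the adjoint partial order on $\mathcal I_n$. That is, for all $v,w\in\mathcal I_n(\lambda,\mu)$, $$\mathcal O^v_{\lambda\mu}\subseteq\overline{\mathcal O^w_{\lambda\mu}}\quad\Longleftrightarrow\quad B\cdot v_<\subseteq\overline{B\cdot w_<}.$$
   Context: Everything is over $\mathbb C$. $B\subset \mathrm{GL}_n(\mathbb C)$ is the subgroup of invertible upper-triangular matrices, and $e_1,\dots,e_n$ is the standard basis of $\mathbb C^n$. Adjoint order. $\mathcal I_n=\{w\in \mathcal S_n\mid w^2=\mathrm{Id}\}$ is the set of involutive permutations of $\{1,\dots,n\}$ (including the identity). $\mathcal X_n$ is the set of strictly upper-triangular complex $n\times n$ matrices $X$ with $X^2=0$; $B$ acts on it by conjugation. For $w\in\mathcal I_n$, $w_<\in\mathcal X_n$ is the matrix with $(w_<)_{ij}=1$ if $w(i)=j$ and $i<j$, and $(w_<)_{ij}=0$ otherwise. Known (Melnikov): $w\mapsto B\cdot w_<$ is a bijection from $\mathcal I_n$ to the set of $B$-orbits in $\mathcal X_n$. The adjoint partial order on $\mathcal I_n$ is: $v\le w$ iff $B\cdot v_<\subseteq\overline{B\cdot w_<}$.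 Double Grassmannian. $\mathrm{Gr}(k,n)$ is the Grassmannian of $k$-dimensional subspaces of $\mathbb C^n$. Write $\lambda=(\lambda_1\ge\dots\ge\lambda_k\ge 0)$ with $\lambda_1\le n-k$, and $\mu=(\mu_1\ge\dots\ge\mu_m\ge0)$ with $\mu_1\le n-m$. Let $U_\lambda=\langle e_{\lambda_k+1},e_{\lambda_{k-1}+2},\dots,e_{\lambda_1+k}\rangle$ and let $X^\circ_\lambda=B\cdot U_\lambda\subset \mathrm{Gr}(k,n)$ be the Schubert cell; similarly $X^\circ_\mu\subset\mathrm{Gr}(m,n)$. $B$ acts diagonally on $\mathrm{Gr}(k,n)\times\mathrm{Gr}(m,n)$, preserving $X^\circ_\lambda\times X^\circ_\mu$. Let $s_i(\lambda)=1$ if $i\in\{\lambda_k+1,\lambda_{k-1}+2,\dots,\lambda_1+k\}$ and $s_i(\lambda)=0$ otherwise; define $s_i(\mu)$ in the same way using $\{\mu_m+1,\mu_{m-1}+2,\dots,\mu_1+m\}$; set $s_i(\lambda,\mu)=s_i(\lambda)+s_i(\mu)\in\{0,1,2\}$ for $1\le i\le n$. The set $\mathcal I_n(\lambda,\mu)\subseteq\mathcal I_n$ consists of all $w\in\mathcal I_n$ such that for every pair $i<j$ with $w(i)=j$ one has $s_i(\lambda,\mu)=0$ and $s_j(\lambda,\mu)=2$. For $w\in\mathcal I_n(\lambda,\mu)$, $\mathcal O^w_{\lambda\mu}\subseteq X^\circ_\lambda\times X^\circ_\mu$ is the $B$-orbit of the pair $(U,W)$ with $$U=\langle e_j\mid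 s_j(\lambda)=1,\ w(j)=j\rangle+\langle e_{w(j)}+e_j\mid s_j(\lambda)=1,\ w(j)\ne j\rangle,\qquad W=\langle e_{\mu_m+1},e_{\mu_{m-1}+2},\dots,e_{\mu_1+m}\rangle.$$ Known: $w\mapsto\mathcal O^w_{\lambda\mu}$ is a bijection from $\mathcal I_n(\lambda,\mu)$ to the set of $B$-orbits in $X^\circ_\lambda\times X^\circ_\mu$. *)

(* Defs.v *)
From HB Require Import structures.
From mathcomp Require Import all_boot all_order all_fingroup all_algebra.
From mathcomp Require Import boolp classical_sets reals.
From mathcomp Require Import complex mpoly.

Set Implicit Arguments.
Unset Strict Implicit.
Unset Printing Implicit Defensive.

Import GRing.Theory.
Local Open Scope classical_set_scope.
Local Open Scope ring_scope.

(* Indices are 0-based: the basis vector e_i of the text is [ebase i'] with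
   [i' = i - 1 : 'I_n].  The complex numbers are [R[i]] for [R : realType]. *)

Section Borel.
Variables (R : realType) (n : nat).
Local Notation C := R[i].

Definition borel : set 'M[C]_n :=
  [set b : 'M[C]_n | b \in unitmx /\ forall i j : 'I_n, (j < i)%N -> b i j = 0].

Definition ebase (i : 'I_n) : 'cV[C]_n := delta_mx i 0.

End Borel.

Section AdjointOrder.
Variables (R : realType) (n : nat).
Local Notation C := R[i].

Definition involutions : {set 'S_n} := [set w : 'S_n | (w * w == 1)%g].

Definition nil2_upper : set 'M[C]_n :=
  [set X : 'M[C]_n | (forall i j : 'I_n, (j <= i)%N -> X i j = 0) /\ X *m X = 0].

Definition inv_lt (w : 'S_n) : 'M[C]_n :=
  \matrix_(i, j) ((w i == j) && (i < j)%N)%:R.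

Definition adj_orbit (X : 'M[C]_n) : set 'M[C]_n :=
  [set b *m X *m invmx b | b in @borel R n].

Definition mx_eval (p : {mpoly C[n * n]}) (X : 'M[C]_n) : C :=
  p.@[fun i => mxvec X 0 i].

(* The Zariski topology of the affine variety [nil2_upper]. *)
Definition nil2_closed (Z : set 'M[C]_n) : Prop :=
  exists P : set {mpoly C[n * n]},
    Z = [set X : 'M[C]_n | nil2_upper X /\ forall p, P p -> mx_eval p X = 0].

Definition nil2_closure (S : set 'M[C]_n) : set 'M[C]_n :=
  smallest nil2_closed S.

End AdjointOrder.

Section DoubleGrassmannian.
Variables (R : realType) (n k m : nat).
Local Notation C := R[i].
Local Notation V := 'cV[C]_n.

Definition Gr (d : nat) : set {vspace V} := [set U : {vspace V} | \dim U = d].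

Definition colspan (d : nat) (A : 'M[C]_(n, d)) : {vspace V} :=
  (\sum_(j < d) <[col j A]>)%VS.

(* [A] is a frame, i.e. its columns are a basis of [colspan A], exactly when
   [Gr d (colspan A)]. *)
Definition pair_eval (p : {mpoly C[n * k + n * m]})
    (A : 'M[C]_(n, k)) (B : 'M[C]_(n, m)) : C :=
  p.@[fun i => row_mx (mxvec A) (mxvec B) 0 i].

(* The Zariski topology of Gr(k, n) x Gr(m, n), as the quotient of the variety
   of pairs of frames by GL_k x GL_m: a set of pairs of subspaces is closed
   when the pairs of frames spanning its members are cut out by polynomials in
   the matrix entries, among all pairs of frames. *)
Definition Gr2_closed (Z : set ({vspace V} * {vspace V})) : Prop :=
  Z `<=` Gr k `*` Gr m /\
  exists P : set {mpoly C[n * k + n * m]},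
    forall (A : 'M[C]_(n, k)) (B : 'M[C]_(n, m)),
      Gr k (colspan A) -> Gr m (colspan B) ->
      (Z (colspan A, colspan B) <-> forall p, P p -> pair_eval p A B = 0).

Definition Gr2_closure (S : set ({vspace V} * {vspace V})) :=
  smallest Gr2_closed S.

Definition vs_act (b : 'M[C]_n) (U : {vspace V}) : {vspace V} :=
  (linfun (mulmx b : V -> V) @: U)%VS.

Definition pair_orbit (UW : {vspace V} * {vspace V}) :
    set ({vspace V} * {vspace V}) :=
  [set (vs_act b UW.1, vs_act b UW.2) | b in @borel R n].

End DoubleGrassmannian.

(* [tnth la r] is the part lambda_(r+1). *)
Definition is_box_partition (n d : nat) (la : d.-tuple nat) : bool :=
  sorted geq la && all (fun x => x <= n - d)%N la.

(* The r-th part contributes the 1-based position lambda_(r+1) + (d - r), i.e.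
   the 0-based position lambda_(r+1) + (d - r - 1). *)
Definition schubert_pos (n d : nat) (la : d.-tuple nat) (i : 'I_n) : bool :=
  [exists r : 'I_d, i == (tnth la r + rev_ord r)%N :> nat].

Section OrbitRepresentatives.
Variables (R : realType) (n k m : nat).
Variables (la : k.-tuple nat) (mu : m.-tuple nat).
Local Notation C := R[i].
Local Notation V := 'cV[C]_n.

Definition s_pair (i : 'I_n) : nat :=
  (schubert_pos la i + schubert_pos mu i)%N.

Definition box_involutions : {set 'S_n} :=
  [set w in @involutions n | [forall i : 'I_n, forall j : 'I_n,
    (i < j)%N && (w i == j) ==> (s_pair i == 0%N) && (s_pair j == 2%N)]].

Definition U_rep (w : 'S_n) : {vspace V} :=
  (\sum_(j | schubert_pos la j && (w j == j)) <[ebase R j]> +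
   \sum_(j | schubert_pos la j && (w j != j)) <[(ebase R (w j) + ebase R j)%R]>)%VS.

Definition W_rep : {vspace V} :=
  (\sum_(j | schubert_pos mu j) <[ebase R j]>)%VS.

Definition O_orbit (w : 'S_n) : set ({vspace V} * {vspace V}) :=
  pair_orbit (U_rep w, W_rep).

End OrbitRepresentatives.

Arguments inv_lt R {n} w.
Arguments O_orbit R {n k m} la mu w.

(* Main.v *)
Require Import Defs.
From HB Require Import structures.
From mathcomp Require Import all_boot all_order all_fingroup all_algebra.
From mathcomp Require Import boolp classical_sets reals complex mpoly.
From mathcomp Require Import zify ring.

(** Let [S0] be the set of positions [i] with [s_i = 0], [S2] the set of those
with [s_i = 2], and [N] the space of strictly upper-triangular matrices
supported on [S0] x [S2].  Elements of [N] have square zero, and [w_<] lies in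
[N] for every [w] in [I_n(la, mu)].  The representative of the orbit of [w] in
the product of Schubert cells is [((1 + w_<) U_la, W_mu)], since [w_<] kills
every vector of the basis of [U_la] that is not the right end of an arc.  So
both orders are governed by the matrices [w_<] in [N], and both are compared
with a third, combinatorial one: [v <= w] when, for all [i] and [j], [v] has at
most as many arcs [a < b] with [i <= a] and [b <= j] as [w].

Closure implies the counting order, because ranks cannot increase in a limit.
For the adjoint action, the rank of the corner of [X] with rows [>= i] and
columns [<= j] is invariant under [B], and at [w_<] it counts arcs.  For pairs
[(U, W)], with [F_j] the span of the [e_a] with [a <= j], the dimension of the
space of those [(x, y)] in [U] x [W] with [x] in [F_j] and [x + y] in [F_(i-1)]
is invariant under [B]; it is the corank of a matrix in the coordinates of
frames ([incidence_mx]).  At [((1 + X) U_la, W_mu)] with [X] in [N] the rank of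
this matrix is the rank of the corner of [X] plus a constant depending only on
[la], [mu], [i] and [j] ([rank_incidence]).

Conversely, the counting order implies both closure relations at once.  Let [K]
be the group of the [b] in [B] whose nonzero off-diagonal entries lie in
[S0] x [S0] or [S2] x [S2].  It acts on [N] by conjugation, and fixes [U_la] and
[W_mu], so that [b ((1 + X) U_la, W_mu)] is [((1 + b X b^-1) U_la, W_mu)].
Hence the set of the [X] in [N] that belong to the adjoint closure, and the set
of those for which the associated pair belongs to the closure of pairs, are
both stable under [K] and under limits along affine lines.  Any such set that
contains [w_<] contains [v_<] as soon as [v <= w] for the counting order
([rook_degeneration]).  This is the description of Bruhat order by rank
functions, transposed to rook placements: from [w] one reaches [v] by elementary
moves that lower one arc count after another without passing below [v], and each
move is a limit of [K]-conjugates along a line.  Each new entry lies above or to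
the right of an old one, so the condition [a < b] on arcs is preserved. *)

Set Implicit Arguments.
Unset Strict Implicit.
Unset Printing Implicit Defensive.

Import GRing.Theory.
Local Open Scope ring_scope.
Local Open Scope classical_set_scope.

(** * Coordinate projections and triangular matrices *)

Section UpperTriangular.
Variables (F : fieldType) (n : nat).
Implicit Types (b c X : 'M[F]_n) (A B : pred 'I_n).

Definition upper b := forall i j : 'I_n, (j < i)%N -> b i j = 0.

Definition coord_proj A : 'M[F]_n := diag_mx (\row_i (A i)%:R).

Lemma coord_projMl A m (X : 'M_(n, m)) i j :
  (coord_proj A *m X) i j = (A i)%:R * X i j.
Proof. by rewrite mul_diag_mx !mxE. Qed.

Lemma coord_projMr A m (X : 'M_(m, n)) i j :
  (X *m coord_proj A) i j = X i j * (A j)%:R.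
Proof. by rewrite mul_mx_diag !mxE. Qed.

Lemma coord_projM A B : coord_proj A *m coord_proj B = coord_proj (predI A B).
Proof.
apply/matrixP=> i j; rewrite coord_projMl !mxE /=.
by case: (A i); rewrite ?mul1r ?mul0r ?mul0rn.
Qed.

Lemma eq_coord_proj A B : A =1 B -> coord_proj A = coord_proj B.
Proof. by move=> AB; apply/matrixP=> i j; rewrite !mxE AB. Qed.

Lemma coord_proj0 A : (forall i, ~~ A i) -> coord_proj A = 0.
Proof. by move=> A0; apply/matrixP=> i j; rewrite !mxE (negPf (A0 i)) mul0rn. Qed.

Lemma coord_projC A : coord_proj (predC A) = 1%:M - coord_proj A.
Proof.
apply/matrixP=> i j; rewrite !mxE /=.
by case: (i == j); case: (A i); rewrite ?mulr1n ?mulr0n ?subr0 ?subrr.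
Qed.

(** The span of the [e_i] with [i < l] is stable under [b], so modulo it the
action of [b] only depends on the coordinates from [l] on. *)
Lemma upper_projl b (l : nat) : upper b ->
  coord_proj (fun i => l <= i)%N *m b
  = coord_proj (fun i => l <= i)%N *m b *m coord_proj (fun i => l <= i)%N.
Proof.
move=> hb; apply/matrixP=> i j; rewrite coord_projMr coord_projMl.
case: (leqP l i) => hi; last by rewrite !mul0r.
case: (leqP l j) => hj; rewrite ?mulr1 // hb ?mulr0 ?mul0r //.
exact: leq_trans hj hi.
Qed.

(** With [P] the projection on the coordinates [>= i] and [P' = 1 - P], the
matrix [d = P b P + P'] has inverse [P c P + P'], and [d (P c P')], equal to
[P b c P' = P P'], vanishes; so [P c P' = 0], and [c i j] is one of its entries. *)
Lemma upper_inv b c : upper b -> b *m c = 1%:M -> upper c.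
Proof.
move=> hb hbc i j ltji.
pose P := coord_proj (fun l : 'I_n => i <= l)%N.
have [P' defP'] : exists P', P' = 1%:M - P by eexists.
have PP : P *m P = P.
  by rewrite coord_projM; apply: eq_coord_proj => l /=; rewrite andbb.
have PP' : P *m P' = 0 by rewrite defP' mulmxBr mulmx1 PP subrr.
have P'P : P' *m P = 0 by rewrite defP' mulmxBl mul1mx PP subrr.
have P'P' : P' *m P' = P' by rewrite {2}defP' mulmxBr mulmx1 P'P subr0.
have Pb : P *m b = P *m b *m P by exact: upper_projl.
have [d defd] : exists d, d = P *m b *m P + P' by eexists.
have h1 : d *m (P *m c *m P + P') = 1%:M.
  rewrite defd mulmxDl !mulmxDr -!mulmxA P'P' (mulmxA P' P) P'P PP' !mulmx0 mul0mx.
  rewrite (mulmxA P P) PP addr0 add0r (mulmxA b) (mulmxA P (b *m P)).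
  rewrite (mulmxA P b P) -Pb -(mulmxA P b) (mulmxA b c P) hbc mul1mx PP.
  by rewrite defP' addrC subrK.
have h2 : d *m (P *m c *m P') = 0.
  rewrite defd mulmxDl -!mulmxA (mulmxA P' P) P'P mul0mx addr0 (mulmxA P P) PP.
  rewrite (mulmxA b) (mulmxA P (b *m P)) (mulmxA P b P) -Pb -(mulmxA P b).
  by rewrite (mulmxA b c P') hbc mul1mx PP'.
have h3 : P *m c *m P' = 0.
  by rewrite -[LHS]mul1mx -(mulmx1C h1) -[LHS]mulmxA h2 mulmx0.
have := congr1 (fun A : 'M_n => A i j) h3.
rewrite defP' /P -coord_projC coord_projMr coord_projMl mxE leqnn /= -ltnNge ltji.
by rewrite mul1r mulr1.
Qed.

Lemma upperM b c : upper b -> upper c -> upper (b *m c).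
Proof.
move=> ub uc i j ji; rewrite mxE big1 // => l _; have [li|il] := ltnP l i.
  by rewrite ub ?mul0r.
by rewrite uc ?mulr0 //; apply: leq_trans ji il.
Qed.

End UpperTriangular.

(** * Degenerations of rook placements *)

Section RookDegeneration.
Variables (F : fieldType) (n : nat) (S0 S2 : pred 'I_n).
Hypothesis S02 : forall i, S0 i -> S2 i -> False.

(** The space [N]. *)
Definition in_shape (X : 'M[F]_n) :=
  forall i j, X i j != 0 -> [/\ S0 i, S2 j & (i < j)%N].

(** The group [K], which acts on [N] by conjugation through the product of its
blocks on [S0] and [S2]. *)
Definition block_upper (b : 'M[F]_n) :=
  upper b /\ forall i j, i != j -> b i j != 0 -> S0 i && S0 j || S2 i && S2 j.

(** [Phi] stands for membership in a closure; only the stability of closures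
under [K] and under limits at [t = 0] along a line is used. *)
Variable Phi : 'M[F]_n -> Prop.
Hypothesis Phi_conj : forall b c X, in_shape X -> block_upper b ->
  b *m c = 1%:M -> Phi X -> Phi (b *m X *m c).
Hypothesis Phi_line : forall X Y, in_shape X -> in_shape Y ->
  (forall t, t != 0 -> Phi (X + t *: Y)) -> Phi X.

(** Carrying the support condition along allows the operations below to be
chained. *)
Let reachable X := in_shape X /\ Phi X.

Lemma in_shape0l X i j : in_shape X -> ~~ S0 i -> X i j = 0.
Proof. by move=> hX hi; apply: contraNeq hi => /hX[]. Qed.

Lemma in_shape0r X i j : in_shape X -> ~~ S2 j -> X i j = 0.
Proof. by move=> hX hj; apply: contraNeq hj => /hX[]. Qed.

(** On [N], conjugating by a transvection or a diagonal matrix of [K] is a plain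
row or column operation: the inverse factor acts trivially on the other side,
because [S0] and [S2] are disjoint. *)
Definition row_op (s : F) (r r' : 'I_n) (X : 'M[F]_n) :=
  \matrix_(i, j) (X i j + (i == r')%:R * s * X r j).
Definition col_op (u : F) (c c' : 'I_n) (X : 'M[F]_n) :=
  \matrix_(i, j) (X i j + (j == c')%:R * u * X i c).
Definition col_scale (t : F) (c : 'I_n) (X : 'M[F]_n) :=
  \matrix_(i, j) (if j == c then t * X i j else X i j).

Lemma transvection_inv (s : F) (a b : 'I_n) : a != b ->
  (1%:M + s *: delta_mx a b) *m (1%:M - s *: delta_mx a b) = 1%:M.
Proof.
move=> ab; rewrite mulmxBr mulmx1 mulmxDl mul1mx -scalemxAl -scalemxAr.
by rewrite mul_delta_mx_0 1?eq_sym // !scaler0 addr0 addrK.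
Qed.

Lemma block_upper_transvection (s : F) (a b : 'I_n) : (a < b)%N ->
  S0 a && S0 b || S2 a && S2 b -> block_upper (1%:M + s *: delta_mx a b).
Proof.
move=> ab hab; split=> [i j ji|i j ij]; rewrite !mxE.
  have ->: (i == j) = false by apply/eqP=> e; rewrite e ltnn in ji.
  rewrite add0r; case: eqP => [ei|]; last by rewrite mulr0.
  case: eqP => [ej|]; last by rewrite mulr0.
  by move: ji; rewrite ei ej ltnNge (ltnW ab).
rewrite (negPf ij) add0r; case: (i =P a) => [->|_]; last by rewrite mulr0 eqxx.
by case: (j =P b) => [->|_]; [|rewrite mulr0 eqxx].
Qed.

Lemma reachable_row_op s r r' X : S0 r -> S0 r' -> (r' < r)%N ->
  reachable X -> reachable (row_op s r r' X).
Proof.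
move=> Sr Sr' rr' [sX PX]; split.
  move=> i j; rewrite !mxE; case: (eqVneq (X i j) 0) => [->|/sX//].
  rewrite add0r; case: (eqVneq i r') => [->|_]; last by rewrite !mul0r eqxx.
  case: (eqVneq (X r j) 0) => [->|/sX[_ Sj rj] _]; first by rewrite mulr0 eqxx.
  by split=> //; apply: ltn_trans rj.
have bl : block_upper (1%:M + s *: delta_mx r' r).
  by apply: block_upper_transvection; rewrite ?Sr ?Sr'.
have nr : r' != r by rewrite neq_ltn rr'.
have := Phi_conj sX bl (transvection_inv s nr) PX.
congr Phi; apply/matrixP=> i j.
rewrite mulmxBr mulmx1 !mulmxDl !mul1mx.
have e : X *m (s *: delta_mx r' r) = 0.
  apply/matrixP=> a b; rewrite !mxE big1 // => l _; rewrite !mxE.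
  case: eqP => [->|_]; last by rewrite !mulr0.
  by rewrite (in_shape0r _ sX) ?mul0r //; apply/negP/(S02 Sr').
rewrite -mulmxA e mulmx0 addr0 subr0 !mxE; congr (_ + _).
rewrite (bigD1 r) //= big1 ?addr0 => [|l lr]; rewrite !mxE ?eqxx ?andbT.
  by case: eqP => _; rewrite ?mulr1 ?mulr0 ?mul0r ?mul1r.
by rewrite (negPf lr) andbF mulr0 mul0r.
Qed.

Lemma reachable_col_op u c c' X : S2 c -> S2 c' -> (c < c')%N ->
  reachable X -> reachable (col_op u c c' X).
Proof.
move=> Sc Sc' cc' [sX PX]; split.
  move=> i j; rewrite !mxE; case: (eqVneq (X i j) 0) => [->|/sX//].
  rewrite add0r; case: (eqVneq j c') => [->|_]; last by rewrite !mul0r eqxx.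
  case: (eqVneq (X i c) 0) => [->|/sX[Si _ ic] _]; first by rewrite mulr0 eqxx.
  by split=> //; apply: ltn_trans cc'.
have bl : block_upper (1%:M + (- u) *: delta_mx c c').
  by apply: block_upper_transvection; rewrite ?Sc ?Sc' ?orbT.
have nr : c != c' by rewrite neq_ltn cc'.
have := Phi_conj sX bl (transvection_inv (- u) nr) PX.
congr Phi; apply/matrixP=> i j.
rewrite !mulmxDl !mul1mx.
have e : (- u *: delta_mx c c') *m X = 0.
  apply/matrixP=> a b; rewrite !mxE big1 // => l _; rewrite !mxE.
  case: (eqVneq l c') => [->|_]; last by rewrite andbF mulr0 mul0r.
  by rewrite (in_shape0l _ sX) ?mulr0 //; apply/negP=> /S02/(_ Sc').
rewrite e mul0mx addr0 mulmxBr mulmx1 scaleNr mulmxN opprK !mxE; congr (_ + _).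
rewrite (bigD1 c) //= big1 ?addr0 => [|l lr]; rewrite !mxE ?eqxx /=.
  by case: eqP => _; rewrite ?mulr1 ?mulr0 ?mul0r ?mul1r // mulrC.
by rewrite (negPf lr) /= !mulr0.
Qed.

Lemma reachable_col_scale t c X : S2 c -> t != 0 ->
  reachable X -> reachable (col_scale t c X).
Proof.
move=> Sc t0 [sX PX]; split.
  move=> i j; rewrite !mxE; case: (j =P c) => [->|_]; last exact: sX.
  by rewrite mulf_eq0 negb_or => /andP[_] /sX.
pose dg (x : F) : 'M_n := diag_mx (\row_i (if i == c then x else 1)).
have hd x y : x * y = 1 -> dg x *m dg y = 1%:M.
  move=> xy; apply/matrixP=> i j; rewrite mul_diag_mx !mxE.
  by case: (i == j); case: (i == c); rewrite ?mulr0 ?xy ?mul1r.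
have bl : block_upper (dg t^-1).
  split=> [i j|i j ij]; rewrite !mxE; last by rewrite (negPf ij) eqxx.
  by case: (i =P j) => [->|//]; rewrite ltnn.
have := Phi_conj sX bl (hd _ _ (mulVf t0)) PX.
congr Phi; apply/matrixP=> i j.
rewrite mul_mx_diag mul_diag_mx !mxE.
have -> : (if i == c then t^-1 else 1) * X i j = X i j.
  case: (eqVneq i c) => [->|_]; last by rewrite mul1r.
  by rewrite (in_shape0l _ sX) ?mulr0 //; apply/negP=> /S02/(_ Sc).
by case: eqP => _; rewrite ?mulr1 // mulrC.
Qed.

Implicit Types f g : 'I_n -> nat.

(** The row [a] has its rook in the column [f a] when [f a < n], and no rook when
[f a = n]; the value [n] then behaves like a column further right. *)
Definition rook_mx f : 'M[F]_n := \matrix_(i, j) (f i == j :> nat)%:R.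

(** For [j >= n] empty rows are counted as well, in agreement with the role of the
value [n] as one more column. *)
Definition rook_count f (i j : nat) : nat :=
  \sum_(a < n) ((i <= a) && (f a <= j))%N.

Definition rooks f :=
  [/\ forall a, (f a <= n)%N,
      forall a (j : 'I_n), f a = j -> [/\ S0 a, S2 j & (a < j)%N]
    & forall a b, f a = f b -> (f a < n)%N -> a = b].

Lemma rook_shape f : rooks f -> in_shape (rook_mx f).
Proof.
case=> _ h _ i j; rewrite !mxE.
by case: (f i =P j :> nat) => [/h //|_]; rewrite eqxx.
Qed.

Lemma rook_count_split f i j c : (j <= c)%N -> rook_count f i c =
  (rook_count f i j + \sum_(a < n) ((i <= a) && (j < f a <= c)))%N.
Proof.
by move=> jc; rewrite /rook_count -big_split; apply: eq_bigr => a _ /=; lia.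
Qed.

Lemma rook_countD1 f i j (r : 'I_n) : rook_count f i j =
  ((i <= r) && (f r <= j) +
   \sum_(a < n | a != r) ((i <= a) && (f a <= j)))%N.
Proof. by rewrite /rook_count (bigD1 r). Qed.

(** Room for lowering the count of [f] at [(i, j)].  At the column [g r] the count
of [g] is at most that of [f].  Going back to the column [j], the count of [g]
loses every row that the count of [f] loses, and the row [r] in addition. *)
Lemma rook_count_lt f g (r : 'I_n) i j :
  (forall i j, rook_count g i j <= rook_count f i j)%N ->
  (forall a : 'I_n, (i <= a)%N -> (j < f a <= g r)%N ->
     (j < g a <= g r)%N /\ a != r) ->
  (i <= r)%N -> (j < g r)%N -> (rook_count g i j < rook_count f i j)%N.
Proof.
move=> le_gf hfg ir jr.
have := le_gf i (g r); rewrite !(rook_count_split _ _ (ltnW jr)).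
suff lt : (\sum_(a < n) ((i <= a) && (j < f a <= g r)) <
           \sum_(a < n) ((i <= a) && (j < g a <= g r)))%N by lia.
rewrite (bigD1 r) //= [X in (_ < X)%N](bigD1 r) //= ir jr leqnn /=.
have -> : (j < f r <= g r)%N = false.
  by apply/negP=> /(hfg r ir)[_]; rewrite eqxx.
rewrite add0n add1n ltnS; apply: leq_sum => a _.
case: (leqP i a) => //= ia.
by case: (boolP (j < f a <= g r)%N) => // /(hfg a ia)[-> _].
Qed.

(** All elementary moves are limits along the direction of the entry which the
moved rook leaves. *)
Lemma rook_limit f f' (r c0 : 'I_n) : f r = c0 -> rooks f -> rooks f' ->
  (forall t, t != 0 -> reachable (rook_mx f' + t *: delta_mx r c0)) ->
  reachable (rook_mx f').
Proof.
move=> fr rf rf' h; split; first exact: rook_shape.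
have [_ sf _] := rf.
apply: (@Phi_line _ (delta_mx r c0)); first exact: rook_shape.
  move=> i j; rewrite !mxE; case: (i =P r) => [->|_]; last by rewrite eqxx.
  by case: (j =P c0) => [->|_]; rewrite ?eqxx // => _; apply: sf.
by move=> t /h[].
Qed.

(** In the rows [r, r'] and columns [c0 = f r, c' = f r'], the limit is the case
[t = 0] of the matrices with rows [(t, 1)] and [(1, 0)].  For [t != 0] these come
from the identity by adding a multiple of row [r] to row [r'] above it and a
multiple of column [c0] to column [c'] on its right, and scaling columns.  When
[f r' = n] only the column [c0] is there: the rook of row [r] moves up. *)
Lemma rook_swap f (r r' : 'I_n) : rooks f -> S0 r' -> (r' < r)%N ->
  (f r < f r')%N -> reachable (rook_mx f) ->
  rooks (f \o tperm r r') /\ reachable (rook_mx (f \o tperm r r')).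
Proof.
move=> rf Sr' rr' lt Pf; have [fn sf injf] := rf.
have frn : (f r < n)%N by apply: leq_trans lt (fn r').
pose c0 := Ordinal frn; have [Sr Sc0 rc0] := sf r c0 erefl.
have nrr : r' != r by rewrite neq_ltn rr'.
have nrr' : (r == r') = false by rewrite eq_sym (negPf nrr).
have rf' : rooks (f \o tperm r r').
  split=> [a|a j|a b] /=; first exact: fn.
  - case: tpermP => [->|->|_ _]; last exact: sf.
      move=> e; have [_ Sj rj] := sf _ _ e; split=> //.
      by rewrite -e (ltn_trans _ lt).
    by move=> /sf[_ Sj rj]; split=> //; apply: ltn_trans rj.
  - by move=> /injf h /h /perm_inj.
split=> //; apply: (@rook_limit f _ r c0) => // t t0.
(* The column c0 of P1 has the entries t in row r and 1 in row r'. *)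
have P1 := reachable_col_scale Sc0 t0 (reachable_row_op t^-1 Sr Sr' rr' Pf).
have fE a : (f a == c0 :> nat) = (a == r).
  apply/eqP/eqP=> [e|-> //]; apply: injf; first by rewrite e.
  by rewrite e ltn_ord.
have [c'n|c'n] := ltnP (f r') n; last first.
  move: P1; congr reachable; apply/matrixP=> i j; rewrite !mxE /=.
  have [->|jc0] := eqVneq j c0.
    rewrite !fE eqxx; case: tpermP => [->|->|/eqP/negPf ir /eqP/negPf ir'].
    + by rewrite eqxx (negPf nrr) eq_sym (negPf nrr) !mul0r addr0 add0r.
    + by rewrite !eqxx (negPf nrr) !mul1r !mulr1 mulr0 addr0 add0r mulfV.
    + by rewrite ir ir' !mul0r mulr0 !addr0 mulr0.
  rewrite andbF mulr0 addr0.
  have frj : (f r == j :> nat) = false.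
    by apply: contraNF jc0 => /eqP e; apply/eqP/val_inj.
  have fr'j : (f r' == j :> nat) = false.
    by rewrite (gtn_eqF (leq_trans (ltn_ord j) c'n)).
  by rewrite frj mulr0 addr0; case: tpermP => [->|->|//]; rewrite frj fr'j.
pose c' := Ordinal c'n; have [_ Sc' rc'] := sf r' c' erefl.
(* Subtracting column c0 from column c' leaves there only - t, in row r. *)
have tN0 : (- t)^-1 != 0 by rewrite invr_eq0 oppr_eq0.
have P2 := reachable_col_scale Sc' tN0 (reachable_col_op (- 1) Sc0 Sc' lt P1).
have fE' a : (f a == c' :> nat) = (a == r').
  by apply/eqP/eqP=> [e|-> //]; apply: injf; rewrite e ?c'n.
have fF a (j : 'I_n) : j != c0 -> j != c' -> f a = j -> (a != r) && (a != r').
  move=> j0 j' e; apply/andP; split; apply/eqP=> ea.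
    by case/eqP: j0; apply: val_inj; rewrite /= -e ea.
  by case/eqP: j'; apply: val_inj; rewrite /= -e ea.
have cc' : (c0 == c') = false.
  by apply/eqP=> /(congr1 val)/= e; move: lt; rewrite -e ltnn.
move: P2; congr reachable; apply/matrixP=> i j; rewrite !mxE /=.
have [->|jc'] := eqVneq j c'.
  rewrite eqxx (eq_sym c') cc' !fE !fE' !eqxx.
  case: tpermP => [->|->|/eqP/negPf ir /eqP/negPf ir'].
  + by rewrite !eqxx ?nrr' ?(negPf nrr) /=; field; rewrite ?oppr_eq0 ?t0.
  + by rewrite !eqxx ?nrr' ?(negPf nrr) /=; field; rewrite ?oppr_eq0 ?t0.
  + by rewrite ?fE' ?ir ?ir' /=; field; rewrite ?oppr_eq0 ?t0.
rewrite !mul0r addr0; have [->|jc0] := eqVneq j c0.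
  rewrite !fE eqxx andbT; case: tpermP => [->|->|/eqP/negPf ir /eqP/negPf ir'].
  + by rewrite eqxx (negPf nrr) eq_sym (negPf nrr) !mul0r addr0 add0r.
  + by rewrite !eqxx (negPf nrr) !mul1r !mulr1 mulr0 addr0 add0r mulfV.
  + by rewrite ir ir' /=; field; rewrite ?t0.
rewrite andbF mulr0 addr0.
have E a : f a = j -> a != r by move/(fF _ _ jc0 jc')/andP=> [].
have E' a : f a = j -> a != r' by move/(fF _ _ jc0 jc')/andP=> [].
have fr : (f r == j :> nat) = false by apply/eqP=> /E; rewrite eqxx.
have fr' : (f r' == j :> nat) = false by apply/eqP=> /E'; rewrite eqxx.
by rewrite fr mulr0 addr0; case: tpermP => [->|->|//]; rewrite fr fr'.
Qed.

(** A rook moves right within its row, or leaves the board if [f' r = n]. *)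
Lemma rook_move f f' (r : 'I_n) : rooks f -> rooks f' -> (f r < f' r)%N ->
  (forall a, a != r -> f' a = f a) ->
  reachable (rook_mx f) -> reachable (rook_mx f').
Proof.
move=> rf rf' lt f'E Pf.
have [fn sf injf] := rf; have [f'n sf' injf'] := rf'.
have frn : (f r < n)%N by apply: leq_trans lt (f'n r).
pose c0 := Ordinal frn; have [Sr Sc0 rc0] := sf r c0 erefl.
have fE a : (f a == c0 :> nat) = (a == r).
  apply/eqP/eqP=> [e|-> //]; apply: injf; first by rewrite e.
  by rewrite e ltn_ord.
apply: (@rook_limit f _ r c0) => // t t0.
have f'c0 a : (f' a == c0 :> nat) = false.
  have [->|ar] := eqVneq a r; first by rewrite gtn_eqF.
  by rewrite f'E // fE (negPf ar).
have [c'n|c'n] := ltnP (f' r) n; last first.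
  have := reachable_col_scale Sc0 t0 Pf.
  congr reachable; apply/matrixP=> i j; rewrite !mxE /=.
  have [->|jc0] := eqVneq j c0; first by rewrite fE f'c0 add0r andbT.
  rewrite andbF mulr0 addr0; congr (nat_of_bool _)%:R.
  have [->|ir] := eqVneq i r; last by rewrite f'E.
  rewrite [RHS](gtn_eqF (leq_trans (ltn_ord j) c'n)).
  by apply: contraNF jc0 => /eqP e; apply/eqP/val_inj.
pose c' := Ordinal c'n; have [_ Sc' _] := sf' r c' erefl.
have := reachable_col_scale Sc0 t0 (reachable_col_op 1 Sc0 Sc' lt Pf).
have cc' : (c0 == c') = false.
  by apply/eqP=> /(congr1 val)/= e; move: lt; rewrite -e ltnn.
congr reachable; apply/matrixP=> i j; rewrite !mxE /=.
have [->|jc0] := eqVneq j c0.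
  by rewrite cc' !mul0r addr0 fE f'c0 add0r andbT.
rewrite andbF mulr0 addr0 mulr1 fE.
have [->|jc'] := eqVneq j c'; rewrite ?mul1r ?mul0r ?addr0 -?natrD.
  have -> : (f i == c' :> nat) = false.
    apply/eqP=> e; have ir : i != r.
      by apply: contraTneq lt => ei; rewrite ei /= in e; rewrite -leqNgt -e.
    have e' : f' i = f' r by rewrite f'E.
    by case/eqP: (ir); apply: injf' e' _; rewrite f'E // e.
  congr _%:R; rewrite add0n; congr nat_of_bool.
  apply/esym; have [->|ir] := eqVneq i r; first exact: eqxx.
  by apply: contraNF ir => /eqP e; apply/eqP; apply: injf'; rewrite e.
congr (nat_of_bool _)%:R.
have [->|ir] := eqVneq i r; last by rewrite f'E.
transitivity false.
  by apply: contraNF jc0 => /eqP e; apply/eqP/val_inj.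
by apply/esym; apply: contraNF jc' => /eqP e; apply/eqP/val_inj.
Qed.

(** Both moves decrease it: sliding a rook to the right decreases its term, and a
swap moves the smaller value of [f] to the row with the smaller coefficient. *)
Definition rook_weight f := (\sum_(a < n) a.+1 * (n - f a))%N.

(** Let [r] be the last row where [f] and [g] differ; comparing the counts from
row [r] on gives [f r < g r].  If some row [a < r] has [f r < f a <= g r], swap the
rook of row [r] with the one of the last such row [r'].  Otherwise the column
[g r] is free in [f], and the rook of row [r] moves there.  In both cases counts
only drop at [(i, j)] with [r' < i <= r], respectively [i <= r], and
[f r <= j < g r]; there no row [a] of [S0] with [i <= a < r] has
[f r < f a <= g r], so [rook_count_lt] leaves the required room. *)
Lemma reachable_rook_le f g : rooks f -> rooks g ->
  (forall i j, rook_count g i j <= rook_count f i j)%N ->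
  reachable (rook_mx f) -> reachable (rook_mx g).
Proof.
have [N] := ubnP (rook_weight f); elim: N f => // N IH f ltN rf rg le_gf Pf.
have [fn sf injf] := rf; have [gn sg injg] := rg.
have [/existsP[r0 nr0]|] := boolP [exists a, f a != g a]; last first.
  rewrite negb_exists => /forallP eq_fg; move: Pf; congr reachable.
  by apply/matrixP=> i j; rewrite !mxE (eqP (negbNE (eq_fg i))).
have [r nr maxr] :
    exists2 r, f r != g r & forall a : 'I_n, (r < a)%N -> f a = g a.
  case: (@arg_maxnP _ r0 (fun a => f a != g a) (@nat_of_ord n) nr0) => r nr maxr.
  exists r => // a ra; apply: contraTeq ra => /maxr; by rewrite -leqNgt.
have lt_r : (f r < g r)%N.
  rewrite ltn_neqAle nr leqNgt; apply/negP=> lt.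
  have := le_gf r (g r); rewrite !(rook_countD1 _ _ _ r) leqnn leqnn /=.
  rewrite [(f r <= _)%N]leqNgt lt /= add0n add1n.
  rewrite (eq_bigr (fun a : 'I_n => (r <= a)%N && (f a <= g r)%N : nat)) ?ltnn //.
  move=> a ar; case: (leqP r a) => // ra; rewrite maxr //.
  by rewrite ltn_neqAle ra andbT eq_sym.
have frn : (f r < n)%N by apply: leq_trans lt_r (gn r).
have [Sr Sc0 rc0] := sf r (Ordinal frn) erefl.
have key i j : (i <= r)%N -> (f r <= j < g r)%N ->
  (forall a : 'I_n, S0 a -> (i <= a < r)%N -> ~~ (f r < f a <= g r)%N) ->
  (rook_count g i j < rook_count f i j)%N.
  move=> ir /andP[frj jgr] h; apply: (@rook_count_lt f g r) => // a ia ha.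
  have ar : a != r by apply: contraTneq ha => ->; lia.
  split=> //; have [ra|ra] := ltnP r a; first by rewrite -maxr.
  have ltar : (a < r)%N by rewrite ltn_neqAle ar.
  (* Rows outside S0 are empty for f and g alike; they count when g r = n. *)
  have nSa : ~~ S0 a.
    by apply/negP=> Sa; have := h a Sa; rewrite ia ltar => /(_ isT); lia.
  have empty f0 : rooks f0 -> f0 a = n.
    case=> f0n sf0 _; apply/eqP; rewrite eqn_leq f0n leqNgt; apply/negP=> lt.
    by have [Sa _ _] := sf0 a (Ordinal lt) erefl; rewrite Sa in nSa.
  by rewrite empty // -(empty f).
have [/existsP[r1 hr1]|] := boolP [exists a : 'I_n,
    [&& S0 a, (a < r)%N & (f r < f a <= g r)%N]].
  have [r' /and3P[Sr' rr' hr'] maxr'] :=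
    @arg_maxnP _ r1 (fun a => [&& S0 a, (a < r)%N & (f r < f a <= g r)%N])
      (@nat_of_ord n) hr1.
  have [lt _] := andP hr'.
  have [rf' Pf'] := rook_swap rf Sr' rr' lt Pf.
  have nrr' : r' != r by rewrite neq_ltn rr'.
  apply: IH Pf' => //.
    rewrite -ltnS; apply: leq_trans ltN; rewrite ltnS.
    rewrite /rook_weight (bigD1 r) //= (bigD1 r') //=.
    rewrite [X in (_ < X)%N](bigD1 r) //= [X in (_ < _ + X)%N](bigD1 r') //=.
    rewrite tpermL tpermR.
    rewrite (eq_bigr (fun a : 'I_n => a.+1 * (n - f a))%N) => [|a /andP[ar ar']].
      have := fn r'; nia.
    by rewrite tpermD // eq_sym.
  move=> i j; rewrite (rook_countD1 (f \o _) _ _ r) (bigD1 r') //= tpermL tpermR.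
  rewrite (eq_bigr (fun a : 'I_n => (i <= a)%N && (f a <= j)%N : nat)); last first.
    by move=> a /andP[ar ar']; rewrite tpermD // eq_sym.
  have := le_gf i j; have := key i j.
  rewrite (rook_countD1 f _ _ r) (bigD1 r') //=.
  set S := (\sum_(_ | _) _)%N => k.
  have {}k : (r' < i <= r)%N -> (f r <= j < f r')%N ->
      (rook_count g i j < (i <= r)%N && (f r <= j)%N
         + ((i <= r')%N && (f r' <= j)%N + S))%N.
    move=> /andP[r'i ir] /andP[rj jr']; apply: k => //; first by lia.
    move=> a Sa /andP[ia ar]; apply/negP=> h.
    by have := maxr' a; rewrite Sa ar h => /(_ isT); lia.
  lia.
rewrite negb_exists => /forallP none.
pose f' a := if a == r then g r else f a.
have f'r : f' r = g r by rewrite /f' eqxx.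
have f'E a : a != r -> f' a = f a by rewrite /f' => /negPf->.
have col_free a : a != r -> f a = g r -> (g r < n)%N -> False.
  move=> ar e lt; have [ra|ra] := ltnP r a.
    by move/eqP: ar; apply; apply: injg; rewrite -maxr // e.
  have [Sa _ _] := sf a (Ordinal lt) e.
  by have := none a; rewrite Sa e lt_r leqnn ltn_neqAle ar ra.
have rf' : rooks f'.
  split=> [a|a j|a b]; rewrite /f'; first by case: ifP.
  - by case: eqP => [->|_]; [apply: sg|apply: sf].
  - case: (eqVneq a r) => [->|ar]; case: (eqVneq b r) => [->|br] //.
    + by move=> /esym e lt; case: (col_free b br e lt).
    + by move=> e lt; case: (col_free a ar e); rewrite -e.
    + exact: injf.
have Pf' : reachable (rook_mx f').
  by apply: (rook_move rf rf' _ f'E Pf); rewrite f'r.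
apply: IH Pf' => //.
  rewrite -ltnS; apply: leq_trans ltN; rewrite ltnS.
  rewrite /rook_weight (bigD1 r) //= [X in (_ < X)%N](bigD1 r) //= f'r.
  rewrite (eq_bigr (fun a : 'I_n => a.+1 * (n - f a))%N) => [|a ar].
    by have := gn r; nia.
  by rewrite f'E.
move=> i j; rewrite (rook_countD1 f' _ _ r) f'r.
rewrite (eq_bigr (fun a : 'I_n => (i <= a)%N && (f a <= j)%N : nat)); last first.
  by move=> a ar; rewrite f'E.
have := le_gf i j; have := key i j.
rewrite (rook_countD1 f _ _ r).
set S := (\sum_(_ | _) _)%N => k.
have {}k : (i <= r)%N -> (f r <= j < g r)%N ->
    (rook_count g i j < (i <= r)%N && (f r <= j)%N + S)%N.
  move=> ir h; apply: k => // a Sa /andP[_ ar].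
  by have := none a; rewrite Sa ar.
lia.
Qed.

Lemma rook_degeneration f g : rooks f -> rooks g ->
  (forall i j, rook_count g i j <= rook_count f i j)%N ->
  Phi (rook_mx f) -> Phi (rook_mx g).
Proof.
move=> rf rg le_gf Pf.
have [] // := reachable_rook_le rf rg le_gf _; split=> //; exact: rook_shape.
Qed.

End RookDegeneration.

(** * Ranks of corners *)

Section Rank.
Variable F : fieldType.

(** For [S] selecting the coordinates in [A], [S S^T = 1] and [S^T S] is the
projection. *)
Lemma rank_coord_proj n (A : {set 'I_n}) :
  \rank (coord_proj F (fun a => a \in A)) = #|A|.
Proof.
pose S : 'M[F]_(#|A|, n) := \matrix_(u, j) (enum_val u == j)%:R.
have SSt : S *m S^T = 1%:M.
  apply/matrixP=> u v; rewrite !mxE (bigD1 (enum_val u)) //= !mxE eqxx mul1r.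
  rewrite big1 ?addr0 => [|j ju]; last by rewrite !mxE eq_sym (negPf ju) mul0r.
  by rewrite (inj_eq enum_val_inj) eq_sym.
have StS : S^T *m S = coord_proj F (fun a => a \in A).
  apply/matrixP=> i j; rewrite !mxE.
  have [iA|iA] := boolP (i \in A); last first.
    rewrite mul0rn big1 // => u _; rewrite !mxE; case: eqP => [e|_].
      by case/negP: iA; rewrite -e enum_valP.
    by rewrite mul0r.
  rewrite (bigD1 (enum_rank_in iA i)) //= !mxE enum_rankK_in // eqxx mul1r.
  rewrite big1 ?addr0 // => u ui; rewrite !mxE; case: eqP => [e|_].
    by case/eqP: ui; apply: enum_val_inj; rewrite enum_rankK_in.
  by rewrite mul0r.
apply/eqP; rewrite eqn_leq -{1}StS (leq_trans (mxrankM_maxr _ _) (rank_leq_row _)).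
rewrite -{1}(mxrank1 F #|A|) -SSt.
apply: leq_trans (mxrankM_maxl _ _) _.
by rewrite -[X in (\rank X <= _)%N]mul1mx -SSt -mulmxA StS mxrankM_maxr.
Qed.

Definition corner n (i j : nat) (X : 'M[F]_n) : 'M[F]_n :=
  coord_proj F (fun a : 'I_n => i <= a)%N *m X
    *m coord_proj F (fun a : 'I_n => a <= j)%N.

(** If [X] is the corner and [D] the projection on the rows that keep their rook,
then [X = D X] and [D = X X^T]. *)
Lemma rank_rook_corner n (S0 S2 : pred 'I_n) (f : 'I_n -> nat) (i j : nat) :
  rooks S0 S2 f -> (j < n)%N ->
  \rank (corner i j (rook_mx F f)) = rook_count f i j.
Proof.
move=> [_ _ injf] jn; set X := corner _ _ _.
pose A := [set a : 'I_n | (i <= a)%N && (f a <= j)%N]%SET.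
have XE a b : X a b = ((a \in A) && (f a == b :> nat))%:R.
  rewrite /X /corner coord_projMr coord_projMl mxE inE -!natrM.
  by congr _%:R; case: eqP => [->|]; lia.
clearbody X.
have -> : rook_count f i j = #|A|.
  rewrite -sum1_card big_mkcond /rook_count; apply: eq_bigr => a _.
  by rewrite inE; case: ifP.
rewrite -rank_coord_proj; apply/eqP; rewrite eqn_leq; apply/andP; split.
  have -> : X = coord_proj F (fun a => a \in A) *m X.
    apply/matrixP=> a b; rewrite coord_projMl !XE; case: (a \in A).
      by rewrite mul1r.
    by rewrite mul0r.
  exact: mxrankM_maxl.
suff -> : coord_proj F (fun a => a \in A) = X *m X^T by exact: mxrankM_maxl.
apply/matrixP=> a b; rewrite !mxE.
have [aA|aA] := boolP (a \in A); last first.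
  by rewrite mul0rn big1 // => c _; rewrite !mxE !XE (negPf aA) mul0r.
have fan : (f a < n)%N by move: aA; rewrite inE; lia.
rewrite (bigD1 (Ordinal fan)) //= !mxE !XE aA eqxx mul1r.
rewrite big1 ?addr0 => [|c ca]; last first.
  rewrite !mxE !XE aA; case: eqP => [e|_]; last by rewrite mul0r.
  by case/eqP: ca; apply: val_inj.
have [e|ab] := eqVneq a b; first by rewrite -e aA eqxx.
case: eqP => [e|_]; last by rewrite andbF.
by case/eqP: ab; apply: injf.
Qed.

(** [e] and [f] separate the supports of [K] and [J], on the rows and on the
columns: [K + J] and the block-diagonal matrix of [K] and [J] factor through each
other. *)
Lemma rank_disjoint_sum m n (e : 'M[F]_m) (f : 'M_n) (K J : 'M[F]_(m, n)) :
  e *m K = K -> e *m J = 0 -> K *m f = K -> J *m f = 0 ->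
  \rank (K + J)%R = (\rank K + \rank J)%N.
Proof.
move=> eK eJ Kf Jf; rewrite -rank_diag_block_mx.
apply/eqP; rewrite eqn_leq; apply/andP; split.
  have -> : K + J = row_mx 1%:M 1%:M *m block_mx K 0 0 J *m col_mx 1%:M 1%:M.
    by rewrite mul_row_block mul_row_col !mul1mx !mulmx1 !addr0 !add0r.
  exact: leq_trans (mxrankM_maxl _ _) (mxrankM_maxr _ _).
have -> : block_mx K 0 0 J
    = col_mx e (1%:M - e) *m (K + J) *m row_mx f (1%:M - f).
  have eKJ : e *m (K + J) = K by rewrite mulmxDr eK eJ addr0.
  rewrite mul_col_mx mulmxBl mul1mx eKJ (addrC K) addrK mul_col_row !mulmxBr.
  by rewrite !mulmx1 Kf Jf subrr subr0.
exact: leq_trans (mxrankM_maxl _ _) (mxrankM_maxr _ _).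
Qed.

End Rank.

Section InShape.
Variables (F : fieldType) (n : nat).
Implicit Types A : pred 'I_n.
Notation cp := (coord_proj F).

Variables (S0 S2 : pred 'I_n) (X : 'M[F]_n).
Hypothesis S02 : forall i, S0 i -> S2 i -> False.
Hypothesis sX : in_shape S0 S2 X.

Lemma in_shape_projl A : (forall i, S0 i -> A i) -> cp A *m X = X.
Proof.
move=> SA; apply/matrixP=> i j; rewrite coord_projMl.
case: (boolP (A i)) => Ai; first by rewrite mul1r.
rewrite mul0r; apply/esym/eqP; apply: contraNT Ai => /sX[S0i _ _]; exact: SA.
Qed.

Lemma in_shape_projr A : (forall i, S2 i -> A i) -> X *m cp A = X.
Proof.
move=> SA; apply/matrixP=> i j; rewrite coord_projMr.
case: (boolP (A j)) => Aj; first by rewrite mulr1.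
rewrite mulr0; apply/esym/eqP; apply: contraNT Aj => /sX[_ S2j _]; exact: SA.
Qed.

Lemma in_shape_projl0 A : (forall i, S0 i -> ~~ A i) -> cp A *m X = 0.
Proof.
move=> SA; rewrite -(@in_shape_projl S0) // mulmxA coord_projM coord_proj0 ?mul0mx //.
by move=> i /=; apply/negP=> /andP[Ai /SA]; rewrite Ai.
Qed.

Lemma in_shape_sqr0 A : X *m cp A *m X = 0.
Proof.
rewrite -{1}(@in_shape_projr S2) // -(mulmxA _ (cp S2)) coord_projM -mulmxA.
rewrite in_shape_projl0 ?mulmx0 // => i S0i; apply/negP=> /andP[S2i _].
exact: S02 S2i.
Qed.

Lemma in_shape_upper : upper X.
Proof.
by move=> i j ji; apply: contraTeq ji => /sX[_ _]; rewrite -leqNgt => /ltnW.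
Qed.

Lemma in_shape_inv : (1%:M - X) *m (1%:M + X) = 1%:M.
Proof.
have XX : X *m X = 0.
  by rewrite -{1}(@in_shape_projr predT) // in_shape_sqr0.
by rewrite mulmxDr mulmx1 mulmxBl mul1mx XX subr0 subrK.
Qed.

(** [L] and [M] are to be the positions of [la] and [mu]. *)
Variables (L M : pred 'I_n).
Hypothesis S0LM : forall i, S0 i -> ~~ L i && ~~ M i.
Hypothesis S2LM : forall i, S2 i -> L i && M i.

(** Row operations by [P X] and [Q X] remove [X] from the upper block and reduce
it to the corner [Q X P'] in the lower one, because [P X = P X P] and [X P X = 0];
a column operation clears the columns common to [L] and [M] from the lower left
block.  What remains is the sum of a matrix [K] independent of [X] and of the
corner.  The corner has its rows in [S0], where the lower blocks of [K] vanish,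
and its columns in [M] and [<= j], where the left blocks of [K] vanish; so ranks
add up. *)
Lemma rank_incidence (i j : nat) :
  let P := cp (fun a : 'I_n => j < a)%N in
  let Q := cp (fun a : 'I_n => i <= a)%N in
  \rank (block_mx (P *m (1%:M + X) *m cp L) 0
                  (Q *m (1%:M + X) *m cp L) (Q *m cp M))
  = (\rank (block_mx (P *m cp L) 0 (Q *m cp (predI L (predC M))) (Q *m cp M))
     + \rank (corner i j X))%N.
Proof.
move=> P Q.
pose P' := cp (fun a : 'I_n => a <= j)%N.
have P'E : P' = 1%:M - P.
  rewrite -coord_projC; apply: eq_coord_proj => a /=; by rewrite -leqNgt.
have XL : X *m cp L = X by apply: in_shape_projr => a /S2LM/andP[].
have PX : P *m X = P *m X *m P by apply: (@upper_projl _ _ _ j.+1 in_shape_upper).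
have XPX : X *m P *m X = 0 by exact: in_shape_sqr0.
have LP : cp L *m P = P *m cp L.
  by rewrite !coord_projM; apply: eq_coord_proj => a /=; rewrite andbC.
set K := block_mx _ _ (Q *m cp (predI _ _)) _.
pose J : 'M[F]_(n + n) := block_mx 0 0 (corner i j X) 0.
have -> : \rank (corner i j X) = \rank J.
  by rewrite /J block_mxEv row_mx0 rank_col_0mx rank_row_mx0.
pose e : 'M[F]_(n + n) := block_mx 1%:M 0 0 (cp (predC S0)).
pose f : 'M[F]_(n + n) :=
  block_mx (cp (predC (predI (fun a : 'I_n => a <= j)%N M))) 0 0 1%:M.
have cornerE : corner i j X = Q *m X *m P' by [].
rewrite -(@rank_disjoint_sum _ _ _ e f K J).
- pose r : 'M[F]_(n + n) := block_mx (1%:M - P *m X) 0 (- (Q *m X)) 1%:M.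
  pose c : 'M[F]_(n + n) := block_mx 1%:M 0 (- cp L) 1%:M.
  have ru : r \in unitmx.
    rewrite unitmxE det_lblock det1 mulr1 -unitmxE.
    have [//] : (1%:M - P *m X \in unitmx) /\ (1%:M + P *m X \in unitmx).
    apply: mulmx1_unit; rewrite mulmxDr mulmx1 mulmxBl mul1mx.
    by rewrite -mulmxA (mulmxA X) XPX mulmx0 subr0 subrK.
  have cu : c \in unitmx by rewrite unitmxE det_lblock !det1 mulr1 unitr1.
  set N := block_mx _ _ _ _.
  have -> : K + J = r *m N *m c.
    have topE : P *m (1%:M + X) *m cp L = P *m cp L + P *m X.
      by rewrite mulmxDr mulmx1 mulmxDl -(mulmxA P X) XL.
    have bottomE : Q *m (1%:M + X) *m cp L = Q *m cp L + Q *m X.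
      by rewrite mulmxDr mulmx1 mulmxDl -(mulmxA Q X) XL.
    have XPL : X *m (P *m cp L) = X *m P by rewrite -LP mulmxA XL.
    have killP : (1%:M - P *m X) *m (P *m cp L + P *m X) = P *m cp L.
      rewrite mulmxBl mul1mx mulmxDr -(mulmxA P X) XPL mulmxA -PX.
      by rewrite -(mulmxA P X) (mulmxA X P) XPX mulmx0 addr0 addrK.
    have killQ : Q *m X *m (P *m cp L + P *m X) = Q *m X *m P.
      by rewrite mulmxDr -!(mulmxA Q X) XPL (mulmxA X P X) XPX mulmx0 addr0 mulmxA.
    rewrite /N /r /c topE bottomE /K /J cornerE P'E !mulmx_block add_block_mx.
    rewrite !(mul0mx, mulmx0, mul1mx, mulmx1, add0r, addr0, oppr0) mulNmx.
    rewrite killP killQ; congr block_mx.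
    have -> : cp (predI L (predC M)) = cp L - cp M *m cp L.
      rewrite -[X in _ = X - _]mul1mx -mulmxBl -coord_projC coord_projM.
      by apply: eq_coord_proj => a /=; rewrite andbC.
    rewrite !mulmxBr mulmx1 mulmxN mulmxA.
    by rewrite addrACA [in RHS](addrC (- _)) -[RHS]addrA; congr (_ + _); exact: addrC.
  rewrite mxrankMfree ?row_free_unit //.
  by rewrite (eqmxMfull N) ?row_full_unit.
- rewrite /e /K mulmx_block !(mul0mx, mulmx0, mul1mx, add0r, addr0) !mulmxA.
  by rewrite !coord_projM; congr block_mx; apply: eq_coord_proj => a /=;
     have := @S0LM a; case: (S0 a) => //= /(_ isT); case: (L a); case: (M a);
     rewrite ?andbF.
- rewrite /e /J mulmx_block !(mul0mx, mulmx0, mul1mx, add0r, addr0) cornerE.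
  rewrite !mulmxA coord_projM in_shape_projl0 ?mul0mx ?block_mx0 // => a Sa /=.
  by rewrite Sa.
- rewrite /f /K mulmx_block !(mul0mx, mulmx0, mulmx1, add0r, addr0) -!mulmxA.
  rewrite !coord_projM; congr block_mx; apply: eq_coord_proj => a /=.
    by case: leqP; rewrite ?andbT.
  by case: (M a); rewrite ?andbF ?andbT.
- rewrite /f /J mulmx_block !(mul0mx, mulmx0, mulmx1, add0r, addr0) cornerE.
  suff -> : Q *m X *m P' *m cp (predC (predI (fun a : 'I_n => (a <= j)%N) M)) = 0.
    by rewrite block_mx0.
  rewrite -(@in_shape_projr M) => [|a /S2LM/andP[]//].
  rewrite -!mulmxA !coord_projM coord_proj0 ?mulmx0 // => a /=.
  by case: (M a); case: leqP.
Qed.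

End InShape.

(** * Polynomials in matrix entries *)

Section Minors.
Variable F : fieldType.

(** Minors of all sizes [> r] are used, which avoids extracting a minor of size
exactly [r + 1] from an invertible submatrix of size [\rank A]. *)
Lemma rank_minorsP m n (A : 'M[F]_(m, n)) r :
  (\rank A <= r)%N <->
  forall k (f : 'I_k -> 'I_m) (g : 'I_k -> 'I_n), (r < k)%N ->
    \det (mxsub f g A) = 0.
Proof.
split=> [rA k f g rk|h].
  apply/eqP; apply: contraTT rA; rewrite -unitfE -unitmxE -row_free_unit => /eqP fr.
  rewrite -ltnNge; apply: leq_trans rk _; rewrite -{1}fr.
  have -> : mxsub f g A = rowsub f 1%:M *m A *m colsub g 1%:M.
    by rewrite -rowsubE mulmx_colsub mulmx1; apply/matrixP=> i j; rewrite !mxE.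
  exact: leq_trans (mxrankM_maxl _ _) (mxrankM_maxr _ _).
rewrite leqNgt; apply/negP=> rk.
pose B := rowsub (maxrankfun A) A.
have rB : row_full B^T by rewrite /row_full mxrank_tr; exact: maxrowsub_free.
have := h _ (maxrankfun A) (fullrankfun rB) rk; apply/eqP.
rewrite -unitfE -unitmxE -unitmx_tr -row_full_unit.
have -> : (mxsub (maxrankfun A) (fullrankfun rB) A)^T
    = rowsub (fullrankfun rB) B^T by apply/matrixP=> i j; rewrite !mxE.
exact: fullrowsub_full.
Qed.

Definition minors N m n (G : 'M[{mpoly F[N]}]_(m, n)) (r : nat) :
    set {mpoly F[N]} :=
  [set p | exists k (f : 'I_k -> 'I_m) (g : 'I_k -> 'I_n),
     (r < k)%N /\ p = \det (mxsub f g G)]%classic.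

Lemma minorsP N m n (G : 'M[{mpoly F[N]}]_(m, n)) r (x : 'I_N -> F) :
  (\rank (map_mx (meval x) G) <= r)%N <-> forall p, minors G r p -> p.@[x] = 0.
Proof.
rewrite rank_minorsP; split=> [h p [k [f [g [rk ->]]]]|h k f g rk].
  by rewrite -det_map_mx map_mxsub h.
by rewrite -map_mxsub det_map_mx; apply: h; exists k, f, g.
Qed.

(** Substituting [h] into [p] before or after applying a retraction [phi] of the
scalars; it covers both polynomial changes of variables and restriction to a
line. *)
Lemma mmap_meval N (S : comNzRingType) (iota : {rmorphism F -> S})
    (h : 'I_N -> S) (p : {mpoly F[N]}) (phi : {rmorphism S -> F}) :
  (forall c, phi (iota c) = c) -> phi (mmap iota h p) = p.@[phi \o h].
Proof.
move=> phiK; rewrite mevalE /mmap rmorph_sum; apply: eq_bigr => m _.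
rewrite rmorphM phiK rmorph_prod; congr (_ * _).
by apply: eq_bigr => i _; rewrite rmorphXn.
Qed.

Lemma meval_comp N M (p : {mpoly F[N]}) (h : 'I_N -> {mpoly F[M]}) :
  exists q : {mpoly F[M]}, forall x, q.@[x] = p.@[fun i => (h i).@[x]].
Proof.
exists (mmap (@mpolyC M F) h p) => x.
by apply: (@mmap_meval _ _ (@mpolyC M F) h p (meval x)) => c; exact: mevalC.
Qed.

End Minors.

(** The restriction of [p] to the line is a polynomial in one variable vanishing at
[1, 2, 3, ...], hence zero. *)
Lemma meval_line_eq0 (F : numFieldType) N (p : {mpoly F[N]}) (u v : 'I_N -> F) :
  (forall t, t != 0 -> p.@[fun i => u i + t * v i] = 0) -> p.@[u] = 0.
Proof.
move=> h; pose q := mmap (@polyC F) (fun i => (u i)%:P + 'X * (v i)%:P) p.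
have qE t : q.[t] = p.@[fun i => u i + t * v i].
  rewrite [LHS](@mmap_meval _ _ _ (@polyC F) _ p (horner_eval t)); last first.
    by move=> c; rewrite /= /horner_eval hornerC.
  by apply: meval_eq => i; rewrite /= /horner_eval !hornerE.
suff q0 : q = 0.
  by have := qE 0; rewrite q0 horner0 => ->; apply: meval_eq => i; rewrite mul0r addr0.
apply/eqP; apply: contraTT (leqnn (size q)) => nq0; rewrite -ltnNge.
have := @max_poly_roots F q [seq i.+1%:R | i <- iota 0 (size q)] nq0.
rewrite size_map size_iota; apply.
  apply/allP=> _ /mapP[i _ ->]; rewrite /root qE h //.
  by rewrite Num.Theory.pnatr_eq0.
rewrite map_inj_uniq ?iota_uniq // => i j /eqP.
by rewrite Num.Theory.eqr_nat => /eqP[].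
Qed.

(** * Involutions as rook placements *)

Section Arcs.
Variables (n k m : nat) (la : k.-tuple nat) (mu : m.-tuple nat).

(** The rook placement of [w_<], with [n] for the rows that carry no left end. *)
Definition arc (w : 'S_n) (a : 'I_n) : nat :=
  if (a < w a)%N then (w a : nat) else n.

Definition free_pos (i : 'I_n) := s_pair la mu i == 0%N.
Definition full_pos (i : 'I_n) := s_pair la mu i == 2%N.

Lemma free_full_pos i : free_pos i -> full_pos i -> False.
Proof. by rewrite /free_pos /full_pos => /eqP->. Qed.

Lemma arcP (w : 'S_n) a (j : 'I_n) : arc w a = j <-> (a < j)%N /\ w a = j.
Proof.
rewrite /arc; split=> [|[aj ->]]; last by rewrite aj.
by case: ifP => [aw /val_inj <- //|_ e]; have := ltn_ord j; rewrite -e ltnn.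
Qed.

Lemma box_involutionP (w : 'S_n) : w \in box_involutions n la mu ->
  (forall a, w (w a) = a) /\
  (forall a : 'I_n, (a < w a)%N -> free_pos a /\ full_pos (w a)).
Proof.
rewrite inE => /andP[]; rewrite inE => /eqP ww /forallP h; split=> a.
  by rewrite -permM ww perm1.
move=> aw; have /forallP/(_ (w a)) := h a.
by rewrite aw eqxx /= => /andP.
Qed.

Lemma arc_rooks w : w \in box_involutions n la mu ->
  rooks free_pos full_pos (arc w).
Proof.
case/box_involutionP=> ww hw; split=> [a|a j /arcP[aj e]|a b].
- by rewrite /arc; case: ifP => // _; apply: ltnW.
- by have := hw a; rewrite e => /(_ aj)[].
- move=> e lt; have /arcP[_ ea] : arc w a = Ordinal lt by [].
  have /arcP[_ eb] : arc w b = Ordinal lt by rewrite -e.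
  by apply: (@perm_inj _ w); rewrite ea eb.
Qed.

Lemma inv_ltE (R : realType) (w : 'S_n) : inv_lt R w = rook_mx _ (arc w).
Proof.
apply/matrixP=> i j; rewrite !mxE; congr (nat_of_bool _)%:R.
apply/andP/eqP=> [[/eqP e ij]|/arcP[ij ->]]; last by rewrite eqxx.
exact/arcP.
Qed.

(** Columns [j >= n] bring no condition: all rows [>= i] are counted. *)
Lemma rook_count_inf (f g : 'I_n -> nat) i j : (n <= j)%N ->
  (forall a, f a <= n)%N -> (forall a, g a <= n)%N ->
  rook_count f i j = rook_count g i j.
Proof.
move=> nj fn gn; apply: eq_bigr => a _.
by rewrite (leq_trans (fn a)) // (leq_trans (gn a)).
Qed.

Lemma arc_count_le (R : realType) (v w : 'S_n) :
  v \in box_involutions n la mu -> w \in box_involutions n la mu ->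
  (forall i j, (j < n)%N ->
    \rank (corner i j (inv_lt R v)) <= \rank (corner i j (inv_lt R w)))%N ->
  forall i j, (rook_count (arc v) i j <= rook_count (arc w) i j)%N.
Proof.
move=> /arc_rooks rv /arc_rooks rw h i j.
have [jn|nj] := ltnP j n; last first.
  by rewrite (rook_count_inf _ nj (g := arc w)) //; [case: rv|case: rw].
have := h i j jn.
by rewrite !inv_ltE (rank_rook_corner _ i rv jn) (rank_rook_corner _ i rw jn).
Qed.

End Arcs.

(** * The adjoint order *)

Section Adjoint.
Variables (R : realType) (n : nat).
Local Notation C := R[i].
Implicit Types (b c X : 'M[C]_n).

Lemma borel1 : borel (1%:M : 'M[C]_n).
Proof.
split=> [|i j ji]; first exact: unitmx1.
by rewrite mxE; case: eqP => // e; rewrite e ltnn in ji.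
Qed.

Lemma borelM b c : borel b -> borel c -> borel (b *m c).
Proof.
by move=> [bu ub] [cu uc]; split; [rewrite unitmx_mul bu|exact: upperM].
Qed.

Lemma borel_of_inv b c : upper b -> b *m c = 1%:M -> borel b.
Proof. by move=> ub /mulmx1_unit[]. Qed.

Lemma nil2_upper_conj b c X : upper b -> b *m c = 1%:M ->
  nil2_upper X -> nil2_upper (b *m X *m c).
Proof.
move=> ub bc [sX XX]; have uc := upper_inv ub bc; split=> [i j ji|].
  rewrite mxE big1 // => l _; rewrite mxE.
  have [jl|lj] := ltnP j l; first by rewrite uc ?mulr0.
  rewrite big1 ?mul0r // => h _; have [hi|ih] := ltnP h i.
    by rewrite ub ?mul0r.
  by rewrite sX ?mulr0 //; apply: leq_trans lj (leq_trans ji ih).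
by rewrite !mulmxA -(mulmxA _ c) (mulmx1C bc) mulmx1 -(mulmxA b) XX mulmx0 mul0mx.
Qed.

Definition mx_vars : 'M[{mpoly C[n * n]}]_n :=
  \matrix_(i, j) 'X_(mxvec_index i j).

Lemma mx_varsE X : map_mx (meval (fun i => mxvec X 0 i)) mx_vars = X.
Proof. by apply/matrixP=> i j; rewrite !mxE mevalXU mxvecE. Qed.

Lemma map_mpolyC (N p q : nat) (x : 'I_N -> C) (A : 'M[C]_(p, q)) :
  map_mx (meval x) (map_mx (@mpolyC N C) A) = A.
Proof. by apply/matrixP=> i j; rewrite !mxE mevalC. Qed.

(** Conjugation is a linear substitution in the coordinates, so it pulls closed
sets back to closed sets. *)
Lemma nil2_closed_preim b c (Z : set 'M[C]_n) : upper b -> b *m c = 1%:M ->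
  nil2_closed Z -> nil2_closed [set X | nil2_upper X /\ Z (b *m X *m c)].
Proof.
move=> ub bc [P ->].
exists [set q | exists2 p, P p & forall X, mx_eval q X = mx_eval p (b *m X *m c)].
apply/seteqP; split=> X [nX hX]; split=> //.
  by move=> q [p Pp ->]; case: hX => _; apply.
split=> [|p Pp]; first exact: nil2_upper_conj.
pose M := map_mx (@mpolyC (n * n) C) b *m mx_vars *m map_mx (@mpolyC _ C) c.
have [q qE] := meval_comp p (fun i => mxvec M 0 i).
have qM Y : mx_eval q Y = mx_eval p (b *m Y *m c).
  rewrite /mx_eval qE; apply: meval_eq => i.
  have -> : b *m Y *m c = map_mx (meval (fun i => mxvec Y 0 i)) M.
    by rewrite !map_mxM !map_mpolyC mx_varsE.
  by rewrite -map_mxvec [in RHS]mxE.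
by rewrite -qM; apply: hX; exists p.
Qed.

Lemma nil2_closed_corner i j r : nil2_closed [set X : 'M[C]_n | nil2_upper X /\
  (\rank (corner i j X) <= r)%N].
Proof.
rewrite /corner; set Q := coord_proj _ _; set P' := coord_proj _ _.
pose G := map_mx (@mpolyC (n * n) C) Q *m mx_vars *m map_mx (@mpolyC _ C) P'.
exists (minors G r); apply/seteqP; split=> X [nX hX]; split=> //.
  apply/minorsP; by rewrite !map_mxM !map_mpolyC mx_varsE.
by move/minorsP: hX; rewrite !map_mxM !map_mpolyC mx_varsE.
Qed.

Lemma in_shape_nil2 (S0 S2 : pred 'I_n) X : (forall i, S0 i -> S2 i -> False) ->
  in_shape S0 S2 X -> nil2_upper X.
Proof.
move=> S02 sX; split=> [i j ji|].
  by apply: contraTeq ji => /sX[_ _]; rewrite ltnNge.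
apply/matrixP=> i j; rewrite !mxE big1 // => l _.
apply/eqP; rewrite mulf_eq0 -[_ || _]negbK negb_or; apply/negP=> /andP[].
by move=> /sX[_ S2l _] /sX[S0l _ _]; apply: S02 S2l.
Qed.

Lemma nil2_closure_conj b c X Y : upper b -> b *m c = 1%:M ->
  nil2_closure (adj_orbit Y) X -> nil2_upper Y ->
  nil2_closure (adj_orbit Y) (b *m X *m c).
Proof.
move=> ub bc hX nY Z [cZ YZ].
have [] // : [set X | nil2_upper X /\ Z (b *m X *m c)] X.
apply: hX; split.
  exact: nil2_closed_preim.
move=> _ [a [au ua] <-]; split.
  by apply: nil2_upper_conj => //; rewrite mulmxV.
apply: YZ; exists (b *m a); first by apply: borelM => //; apply: borel_of_inv bc.
have [bu _] := mulmx1_unit bc.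
have -> : invmx (b *m a) = invmx a *m c.
  rewrite -[RHS]mulmx1 -(@mulmxV _ _ (b *m a)) ?unitmx_mul ?bu //.
  by rewrite !mulmxA -(mulmxA _ c b) (mulmx1C bc) mulmx1 mulVmx // mul1mx.
by rewrite !mulmxA.
Qed.

Lemma adj_orbit_refl X : adj_orbit X X.
Proof. by exists 1%:M; [exact: borel1|rewrite mul1mx invmx1 mulmx1]. Qed.

End Adjoint.

Section AdjointOrder.
Variables (R : realType) (n k m : nat) (la : k.-tuple nat) (mu : m.-tuple nat).
Variables (v w : 'S_n).
Hypothesis (hv : v \in box_involutions n la mu).
Hypothesis (hw : w \in box_involutions n la mu).

Let shape_w : in_shape (free_pos la mu) (full_pos la mu) (inv_lt R w).
Proof. by rewrite inv_ltE; apply/rook_shape/arc_rooks. Qed.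

Let nil2_w : nil2_upper (inv_lt R w).
Proof. by apply: in_shape_nil2 shape_w => i; apply: free_full_pos. Qed.

(** The corner of [b X b^-1] is a product of matrices one of which is the corner
of [X], because [b] is triangular; so the set where this rank is at most its
value at [w_<] is closed and contains the orbit of [w_<]. *)
Lemma adj_le_count :
  adj_orbit (inv_lt R v) `<=` nil2_closure (adj_orbit (inv_lt R w)) ->
  forall i j, (rook_count (arc v) i j <= rook_count (arc w) i j)%N.
Proof.
move=> vw; apply: (@arc_count_le _ _ _ _ _ R _ _ hv hw) => i j jn.
have [] // : [set X | nil2_upper X /\
  (\rank (corner i j X) <= \rank (corner i j (inv_lt R w)))%N] (inv_lt R v).
apply: vw (adj_orbit_refl _) _ _; split; first exact: nil2_closed_corner.
move=> _ [b [bu ub] <-].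
have bc : b *m invmx b = 1%:M by rewrite mulmxV.
split; first exact: nil2_upper_conj.
have uc := upper_inv ub bc.
have eQ := upper_projl i ub.
have eP : invmx b *m coord_proj _ (fun a : 'I_n => a <= j)%N
    = coord_proj _ (fun a : 'I_n => a <= j)%N *m
      (invmx b *m coord_proj _ (fun a : 'I_n => a <= j)%N).
  apply/matrixP=> p q; rewrite coord_projMl coord_projMr.
  have [qj|jq] := leqP q j; last by rewrite !mulr0.
  have [pj|jp] := leqP p j; first by rewrite mul1r.
  by rewrite uc ?mul0r ?mulr0 //; apply: leq_ltn_trans jp.
rewrite /corner !mulmxA eQ -(mulmxA _ (invmx b)) eP.
have -> : forall A B X P D : 'M[R[i]]_n,
    A *m B *m A *m X *m (P *m D) = A *m B *m (A *m X *m P) *m D.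
  by move=> *; rewrite !mulmxA.
exact: leq_trans (mxrankM_maxl _ _) (mxrankM_maxr _ _).
Qed.

Lemma count_adj_le :
  (forall i j, rook_count (arc v) i j <= rook_count (arc w) i j)%N ->
  adj_orbit (inv_lt R v) `<=` nil2_closure (adj_orbit (inv_lt R w)).
Proof.
move=> le_vw _ [b [bu ub] <-].
apply: nil2_closure_conj => //; first by rewrite mulmxV.
rewrite (inv_ltE R v).
refine (@rook_degeneration R[i] n _ _ (@free_full_pos n k m la mu)
    (nil2_closure (adj_orbit (inv_lt R w))) _ _ (arc w) (arc v)
    (arc_rooks hw) (arc_rooks hv) le_vw _).
- by move=> a c X _ [ua _] ac hX; exact: (nil2_closure_conj ua ac hX nil2_w).
- move=> X Y sX sY h Z [[P eZ] YZ]; rewrite eZ.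
  split; first by apply: in_shape_nil2 sX => i; apply: free_full_pos.
  move=> p Pp; apply: (@meval_line_eq0 _ _ _ _ (fun i => mxvec Y 0 i)) => t t0.
  have : Z (X + t *: Y) by apply: h => //; split=> //; exists P.
  rewrite eZ => -[_ /(_ p Pp)] <-; apply: meval_eq => i.
  by case/mxvec_indexP: i => a a1; rewrite !mxvecE !mxE.
- by rewrite -inv_ltE => Z [_]; apply; exact: adj_orbit_refl.
Qed.

End AdjointOrder.

(** * Frames and incidence matrices *)

Section Frames.
Variables (R : realType) (n : nat).
Local Notation C := R[i].
Local Notation V := 'cV[C]_n.

Lemma mulmx_sum_col d (A : 'M[C]_(n, d)) (x : 'cV[C]_d) :
  A *m x = \sum_j x j 0 *: col j A.
Proof.
apply/matrixP=> i j; rewrite ord1 mxE summxE; apply: eq_bigr => l _.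
by rewrite !mxE mulrC.
Qed.

Lemma colspanM d e (A : 'M[C]_(n, d)) (g : 'M[C]_(d, e)) :
  (colspan (A *m g) <= colspan A)%VS.
Proof.
apply/subv_sumP=> j _; rewrite -memvE.
have -> : col j (A *m g) = A *m col j g by rewrite !colE mulmxA.
rewrite mulmx_sum_col; apply: memv_suml => l _; apply: memvZ.
by apply: subvP (memv_line _); apply: (sumv_sup l).
Qed.

(** Makes functions of frames that are monotone under right multiplication
well defined on subspaces. *)
Lemma colspan_factor d e (A : 'M[C]_(n, d)) (B : 'M[C]_(n, e)) :
  (colspan B <= colspan A)%VS -> exists g, B = A *m g.
Proof.
move=> sBA.
have h (j : 'I_e) : exists x : 'cV[C]_d, col j B = A *m x.
  have /(subvP sBA) : col j B \in colspan B.
    by apply: subvP (memv_line _); apply: (sumv_sup j).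
  case/memv_sumP=> u uA ->.
  have h' l : exists c, u l = c *: col l A by apply/vlineP/uA.
  have [c cE] := fin_all_exists h'.
  exists (\col_l c l); rewrite mulmx_sum_col; apply: eq_bigr => l _.
  by rewrite cE mxE.
have [x xE] := fin_all_exists h.
exists (\matrix_(l, j) x j l 0); apply/matrixP=> i j.
have := congr1 (fun M : 'cV_n => M i 0) (xE j); rewrite !mxE => ->.
by apply: eq_bigr => l _; rewrite mxE.
Qed.

Lemma vs_act_colspan d b (A : 'M[C]_(n, d)) :
  vs_act b (colspan A) = colspan (b *m A).
Proof.
rewrite /vs_act limg_sum; apply: eq_bigr => j _.
by rewrite limg_line lfunE /= !colE mulmxA.
Qed.

Lemma dim_colspan d (A : 'M[C]_(n, d)) (L : 'M[C]_(d, n)) :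
  L *m A = 1%:M -> Gr d (colspan A).
Proof.
move=> LA; rewrite /Gr /=.
pose X := [tuple col j A | j < d].
have -> : colspan A = <<X>>%VS.
  by rewrite span_def big_tuple /colspan; apply: eq_bigr => j _; rewrite tnth_mktuple.
suff /eqP -> : free X by rewrite size_tuple.
apply/freeP=> c; rewrite (eq_bigr (fun j => (\col_l c l) j 0 *: col j A)).
  rewrite -mulmx_sum_col => /(congr1 (mulmx L)).
  rewrite mulmxA LA mul1mx mulmx0 => /matrixP e j.
  by have := e j 0; rewrite !mxE.
by move=> j _; rewrite mxE -tnth_nth tnth_mktuple.
Qed.

Lemma vs_actM b c (U : {vspace V}) : vs_act b (vs_act c U) = vs_act (b *m c) U.
Proof.
rewrite /vs_act -limg_comp; congr (_ @: _)%VS.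
by apply/lfunP=> x; rewrite comp_lfunE !lfunE /= mulmxA.
Qed.

Lemma vs_act1 (U : {vspace V}) : vs_act 1%:M U = U.
Proof.
rewrite /vs_act -[RHS]lim1g; congr (_ @: _)%VS.
by apply/lfunP=> x; rewrite !lfunE /= mul1mx.
Qed.

Lemma dim_vs_act b c (U : {vspace V}) : c *m b = 1%:M ->
  \dim (vs_act b U) = \dim U.
Proof.
move=> cb; rewrite /vs_act limg_dim_eq // (_ : lker _ = 0%VS) ?capv0 //.
apply/eqP; rewrite -subv0; apply/subvP=> x; rewrite memv_ker lfunE /= => /eqP bx.
by rewrite memv0 -[x]mul1mx -cb -mulmxA bx mulmx0.
Qed.

End Frames.

Section Incidence.
Variables (F : fieldType) (n : nat).
Implicit Types b : 'M[F]_n.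

(** The matrix of the map [U] x [W -> V / F_j] x [V / F_(i-1)] sending [(x, y)] to
[(x, x + y)], when the columns of [A] and [B] are bases of [U] and [W].  It
sees the arcs ending at [b <= j]: the vectors [e_b + e_(w b)] of [U] and [e_b] of
[W] agree modulo [F_(i-1)] unless [i <= w b]. *)
Definition incidence_mx k m (i j : nat) (A : 'M[F]_(n, k)) (B : 'M[F]_(n, m)) :
    'M[F]_(n + n, k + m) :=
  block_mx (coord_proj F (fun a : 'I_n => j < a)%N *m A) 0
           (coord_proj F (fun a : 'I_n => i <= a)%N *m A)
           (coord_proj F (fun a : 'I_n => i <= a)%N *m B).

Lemma incidence_mxM k m k' m' i j (A : 'M_(n, k)) (B : 'M_(n, m))
    (g : 'M_(k, k')) (h : 'M_(m, m')) :
  incidence_mx i j (A *m g) (B *m h) = incidence_mx i j A B *m block_mx g 0 0 h.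
Proof. by rewrite mulmx_block !mulmx0 !mul0mx !addr0 !add0r -!mulmxA. Qed.

Lemma incidence_upper k m i j b (A : 'M_(n, k)) (B : 'M_(n, m)) : upper b ->
  (\rank (incidence_mx i j (b *m A) (b *m B)) <= \rank (incidence_mx i j A B))%N.
Proof.
move=> ub; have eP := upper_projl j.+1 ub; have eQ := upper_projl i ub.
rewrite /incidence_mx; set P := coord_proj _ _ in eP *; set Q := coord_proj _ _ in eQ *.
have -> : block_mx (P *m (b *m A)) 0 (Q *m (b *m A)) (Q *m (b *m B))
  = block_mx (P *m b) 0 0 (Q *m b) *m block_mx (P *m A) 0 (Q *m A) (Q *m B).
  by rewrite mulmx_block !mulmx0 !mul0mx !addr0 !add0r !mulmxA -eP -eQ.
exact: mxrankM_maxr.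
Qed.

End Incidence.

Section ClosedPairs.
Variables (R : realType) (n k m : nat).
Local Notation C := R[i].
Implicit Types (A : 'M[C]_(n, k)) (B : 'M[C]_(n, m)).

Definition pair_point A B : 'I_(n * k + n * m) -> C :=
  fun i => row_mx (mxvec A) (mxvec B) 0 i.

Definition fst_vars : 'M[{mpoly C[n * k + n * m]}]_(n, k) :=
  \matrix_(i, j) 'X_(lshift _ (mxvec_index i j)).
Definition snd_vars : 'M[{mpoly C[n * k + n * m]}]_(n, m) :=
  \matrix_(i, j) 'X_(rshift _ (mxvec_index i j)).

Lemma fst_varsE A B : map_mx (meval (pair_point A B)) fst_vars = A.
Proof.
by apply/matrixP=> i j; rewrite !mxE mevalXU /pair_point row_mxEl mxvecE.
Qed.

Lemma snd_varsE A B : map_mx (meval (pair_point A B)) snd_vars = B.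
Proof.
by apply/matrixP=> i j; rewrite !mxE mevalXU /pair_point row_mxEr mxvecE.
Qed.

Lemma pair_eval_act b (p : {mpoly C[n * k + n * m]}) :
  exists q, forall A B, pair_eval q A B = pair_eval p (b *m A) (b *m B).
Proof.
pose M := row_mx (mxvec (map_mx (@mpolyC (n * k + n * m) C) b *m fst_vars))
                 (mxvec (map_mx (@mpolyC (n * k + n * m) C) b *m snd_vars)).
have [q qE] := meval_comp p (fun i => M 0 i).
exists q => A B; rewrite /pair_eval qE; apply: meval_eq => i.
have -> : row_mx (mxvec (b *m A)) (mxvec (b *m B))
    = map_mx (meval (pair_point A B)) M.
  by rewrite map_row_mx !map_mxvec !map_mxM map_mpolyC fst_varsE snd_varsE.
by rewrite [in RHS]mxE.
Qed.

(** Acting on the left is a linear substitution in the entries of both frames. *)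
Lemma Gr2_closed_preim b c (Z : set ({vspace 'cV[C]_n} * {vspace 'cV[C]_n})) :
  c *m b = 1%:M -> Gr2_closed k m Z ->
  Gr2_closed k m [set UW | [/\ Gr k UW.1, Gr m UW.2
                            & Z (vs_act b UW.1, vs_act b UW.2)]].
Proof.
move=> cb [_ [P PZ]]; split; first by move=> [U W] /= [].
exists [set q | exists2 p, P p &
  forall A B, pair_eval q A B = pair_eval p (b *m A) (b *m B)] => A B gA gB.
have gbA : Gr k (colspan (b *m A)).
  by rewrite -vs_act_colspan /Gr /= (dim_vs_act _ cb).
have gbB : Gr m (colspan (b *m B)).
  by rewrite -vs_act_colspan /Gr /= (dim_vs_act _ cb).
rewrite /= !vs_act_colspan; split.
  by case=> _ _ /(PZ _ _ gbA gbB) h q [p Pp ->]; apply: h.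
move=> h; split=> //; apply/(PZ _ _ gbA gbB) => p Pp.
have [q qE] := pair_eval_act b p.
by rewrite -qE; apply: h; exists p.
Qed.

Lemma incidence_colspan i j A B A' B' :
  (colspan A' <= colspan A)%VS -> (colspan B' <= colspan B)%VS ->
  (\rank (incidence_mx i j A' B') <= \rank (incidence_mx i j A B))%N.
Proof.
move=> /colspan_factor[g ->] /colspan_factor[h ->].
by rewrite incidence_mxM mxrankM_maxl.
Qed.

(** Two pairs of frames of the same subspaces are obtained from each other by
factors on the right, so they have the same rank, and the minors cut out this
set among all frames. *)
Lemma Gr2_closed_incidence i j r : Gr2_closed k m
  [set UW : {vspace 'cV[C]_n} * {vspace 'cV[C]_n} | exists A B,
    [/\ Gr k (colspan A), Gr m (colspan B), UW = (colspan A, colspan B)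
      & (\rank (incidence_mx i j A B) <= r)%N]].
Proof.
split; first by move=> [U W] /= [A [B [gA gB [-> ->] _]]].
pose cst p q (A : 'M[C]_(p, q)) := map_mx (@mpolyC (n * k + n * m) C) A.
pose G := block_mx (cst _ _ (coord_proj _ (fun a : 'I_n => j < a)%N) *m fst_vars) 0
           (cst _ _ (coord_proj _ (fun a : 'I_n => i <= a)%N) *m fst_vars)
           (cst _ _ (coord_proj _ (fun a : 'I_n => i <= a)%N) *m snd_vars).
have GE A B : map_mx (meval (pair_point A B)) G = incidence_mx i j A B.
  rewrite /G /cst map_block_mx map_mx0 /incidence_mx.
  by congr block_mx; rewrite map_mxM map_mpolyC ?fst_varsE ?snd_varsE.
exists (minors G r) => A B gA gB; rewrite -[X in _ <-> X](minorsP G r (pair_point A B)) GE.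
split=> [[A' [B' [_ _ [eA eB] rk]]]|rk]; last by exists A, B.
by apply: leq_trans rk; apply: incidence_colspan; rewrite (eA, eB).
Qed.

End ClosedPairs.

(** * Orbits in products of Schubert cells *)

Section SchubertFrame.
Variables (R : realType) (n d : nat) (la : d.-tuple nat).
Hypothesis (hd : (d <= n)%N) (hla : is_box_partition n la).
Local Notation C := R[i].

(** Its columns are the [e_i] with [i] a position of [la], in decreasing order. *)
Definition schubert_frame : 'M[C]_(n, d) :=
  \matrix_(i, r) (i == (tnth la r + rev_ord r)%N :> nat)%:R.

Lemma schubert_index (r : 'I_d) :
  exists2 i : 'I_n, i = (tnth la r + rev_ord r)%N :> nat & schubert_pos la i.
Proof.
have lt : (tnth la r + rev_ord r < n)%N.
  have /andP[_ /allP/(_ _ (mem_tnth r la))] := hla.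
  by have := ltn_ord r; rewrite /=; lia.
by exists (Ordinal lt) => //; apply/existsP; exists r.
Qed.

Lemma schubert_index_inj (r s : 'I_d) :
  (tnth la r + rev_ord r)%N = (tnth la s + rev_ord s)%N -> r = s.
Proof.
wlog rs : r s / (r <= s)%N.
  by move=> h; have [/h//|/ltnW/h h' /esym/h'] := leqP r s.
have /andP[srt _] := hla.
have geq_trans : transitive geq by move=> a b c ab bc; apply: leq_trans bc ab.
have := sorted_leq_nth geq_trans leqnn 0%N srt.
move=> /(_ r s); rewrite !inE !size_tuple => /(_ (ltn_ord r) (ltn_ord s) rs).
rewrite -!tnth_nth /= => le e; apply: val_inj => /=.
by have := ltn_ord r; have := ltn_ord s; move: le e; rewrite /geq /=; lia.
Qed.

Lemma schubert_frameK : schubert_frame^T *m schubert_frame = 1%:M.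
Proof.
apply/matrixP=> r s; rewrite !mxE; have [i ei _] := schubert_index r.
rewrite (bigD1 i) //= !mxE -ei eqxx mul1r big1 ?addr0 => [|j ji].
  congr (nat_of_bool _)%:R; apply/eqP/eqP=> [e|<- //].
  by apply: schubert_index_inj; rewrite -e.
rewrite !mxE -ei; case: eqP => [e|_]; last by rewrite mul0r.
by case/eqP: ji; apply: val_inj.
Qed.

Lemma schubert_frame_proj :
  schubert_frame *m schubert_frame^T = coord_proj C (schubert_pos la).
Proof.
apply/matrixP=> i j; rewrite !mxE.
have [/existsP[r /eqP er]|nr] := boolP (schubert_pos la i).
  rewrite (bigD1 r) //= !mxE -er eqxx mul1r big1 ?addr0 => [|s sr].
    by rewrite eq_sym.
  rewrite !mxE; case: eqP => [e|_]; last by rewrite mul0r.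
  by case/eqP: sr; apply: schubert_index_inj; rewrite -er -e.
rewrite mul0rn big1 // => r _; rewrite !mxE; case: eqP => [e|_]; last by rewrite mul0r.
by case/negP: nr; apply/existsP; exists r; apply/eqP.
Qed.

Lemma colspan_schubert (M : 'M[C]_n) : colspan (M *m schubert_frame)
  = (\sum_(j | schubert_pos la j) <[M *m ebase R j]>)%VS.
Proof.
have colE r (i : 'I_n) : i = (tnth la r + rev_ord r)%N :> nat ->
    col r (M *m schubert_frame) = M *m ebase R i.
  move=> ei; rewrite colE -mulmxA -colE; congr (_ *m _).
  by apply/matrixP=> a b; rewrite !mxE -ei ord1 andbT.
apply/eqP; rewrite eqEsubv; apply/andP; split; apply/subv_sumP.
  move=> r _; have [i ei si] := schubert_index r.
  by rewrite (colE r i ei); apply: (sumv_sup i).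
move=> i /existsP[r /eqP ei]; rewrite -(colE r i ei).
exact: (sumv_sup r).
Qed.

Lemma Gr_schubert (b c : 'M[C]_n) : c *m b = 1%:M ->
  Gr d (colspan (b *m schubert_frame)).
Proof.
move=> cb; apply: (@dim_colspan _ _ _ _ (schubert_frame^T *m c)).
by rewrite mulmxA -(mulmxA _ c) cb mulmx1 schubert_frameK.
Qed.

(** Coordinate subspaces spanned by positions that [b] maps among themselves are
[b]-stable; equality then follows from dimensions. *)
Lemma colspan_schubert_act (b c : 'M[C]_n) : b *m c = 1%:M ->
  (forall i j, b i j != 0 -> schubert_pos la j -> schubert_pos la i) ->
  colspan (b *m schubert_frame) = colspan schubert_frame.
Proof.
move=> bc stab; pose D := coord_proj C (@schubert_pos n _ la).
have DbD : D *m b *m D = b *m D.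
  apply/matrixP=> i j; rewrite !coord_projMr coord_projMl.
  have [sj|sj] := boolP (schubert_pos la j); last by rewrite !mulr0.
  have [si|si] := boolP (schubert_pos la i); first by rewrite mul1r.
  rewrite mul0r mul0r mulr1; apply/esym/eqP.
  by apply: contraNT si => bij; apply: stab bij sj.
apply/eqP; rewrite eqEdim; apply/andP; split; last first.
  by rewrite -vs_act_colspan (dim_vs_act _ (mulmx1C bc)) leqnn.
have -> : b *m schubert_frame =
    schubert_frame *m (schubert_frame^T *m b *m schubert_frame).
  rewrite -{1}[schubert_frame]mulmx1 -schubert_frameK (mulmxA schubert_frame).
  rewrite schubert_frame_proj mulmxA -DbD /D -schubert_frame_proj.
  by rewrite -!mulmxA schubert_frameK mulmx1.
exact: colspanM.
Qed.

End SchubertFrame.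

Section DoubleGrassmannian.
Variables (R : realType) (n k m : nat).
Variables (la : k.-tuple nat) (mu : m.-tuple nat).
Hypothesis (hk : (k <= n)%N) (hm : (m <= n)%N).
Hypothesis (hla : is_box_partition n la) (hmu : is_box_partition n mu).
Local Notation C := R[i].
Local Notation EL := (schubert_frame R n la).
Local Notation EM := (schubert_frame R n mu).
Local Notation S0 := (@free_pos n k m la mu).
Local Notation S2 := (@full_pos n k m la mu).

Lemma free_posP i : S0 i -> ~~ schubert_pos la i && ~~ schubert_pos mu i.
Proof. by rewrite /free_pos /s_pair; case: schubert_pos; case: schubert_pos. Qed.

Lemma full_posP i : S2 i -> schubert_pos la i && schubert_pos mu i.
Proof. by rewrite /full_pos /s_pair; case: schubert_pos; case: schubert_pos. Qed.

(** [X] in [N] has square zero, so [1 + X] is its exponential; [pair_of X] moves the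
base point of the product of the cells by it on the first factor only. *)
Definition pair_frame (X : 'M[C]_n) := (1%:M + X) *m EL.

Definition pair_of (X : 'M[C]_n) := (colspan (pair_frame X), colspan EM).

Lemma W_repE : W_rep R n mu = colspan EM.
Proof.
rewrite -[EM]mul1mx colspan_schubert //.
by apply: eq_bigr => j _; rewrite mul1mx.
Qed.

(** Every position of [la] is a fixed point of [w] or a right end, since left ends
are in [S0]; and [w_<] maps a right end [e_j] to [e_(w j)]. *)
Lemma U_repE w : w \in box_involutions n la mu ->
  U_rep R la w = colspan ((1%:M + inv_lt R w) *m EL).
Proof.
move=> hw; have [ww wS] := box_involutionP hw.
rewrite colspan_schubert // (bigID (fun j => w j == j)) /=.
have inv_ltM j : schubert_pos la j ->
    (1%:M + inv_lt R w) *m ebase R j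
    = if w j == j then ebase R j else ebase R (w j) + ebase R j.
  move=> sj; rewrite mulmxDl mul1mx.
  have wj : (w j <= j)%N.
    rewrite leqNgt; apply/negP=> /wS[/free_posP].
    by rewrite sj.
  have -> : inv_lt R w *m ebase R j = if w j == j then 0 else ebase R (w j).
    rewrite -colE; apply/matrixP=> a b; rewrite ord1 !mxE.
    have -> : (w a == j) = (a == w j).
      by apply/eqP/eqP=> [<-|->]; rewrite ww.
    case: (w j =P j) => [e|ne]; rewrite !mxE ?andbT.
      rewrite e; case: eqP => // ->; by rewrite ltnn.
    case: eqP => //= ->; rewrite ltn_neqAle wj andbT.
    by case: eqP => // /val_inj.
  by case: ifP => _; rewrite ?addr0 // addrC.
by rewrite /U_rep; congr (_ + _)%VS; apply: eq_bigr => j /andP[sj wj];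
  rewrite inv_ltM // ?wj ?(negPf wj).
Qed.

Lemma O_orbitE w : w \in box_involutions n la mu ->
  O_orbit R la mu w = pair_orbit (pair_of (inv_lt R w)).
Proof. by move=> hw; rewrite /O_orbit U_repE // W_repE. Qed.

(** Padding the frames with zero columns to [n] columns, by [EL^T] and [EM^T] on
the right, brings the matrices to the form of [rank_incidence]. *)
Lemma incidence_le_corner (X Y : 'M[C]_n) (i j : nat) :
  in_shape S0 S2 X -> in_shape S0 S2 Y ->
  (\rank (incidence_mx i j (pair_frame X) EM)
     <= \rank (incidence_mx i j (pair_frame Y) EM))%N
  = (\rank (corner i j X) <= \rank (corner i j Y))%N.
Proof.
move=> sX sY; have S02 := @free_full_pos n k m la mu.
have free : row_free (block_mx EL^T 0 0 EM^T).
  apply/row_freeP; exists (block_mx EL 0 0 EM).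
  rewrite mulmx_block !(mul0mx, mulmx0, add0r, addr0) !schubert_frameK //.
  by rewrite -scalar_mx_block.
rewrite -!(mxrankMfree _ free) -!incidence_mxM /incidence_mx.
rewrite -!mulmxA !schubert_frame_proj // !mulmxA.
rewrite (rank_incidence S02 sX free_posP full_posP).
by rewrite (rank_incidence S02 sY free_posP full_posP) leq_add2l.
Qed.

Lemma Gr_pair_of (X : 'M[C]_n) : in_shape S0 S2 X ->
  Gr k (pair_of X).1 /\ Gr m (pair_of X).2.
Proof.
move=> sX; split; rewrite /pair_of /=.
  apply: Gr_schubert => //.
  exact: in_shape_inv (@free_full_pos _ _ _ la mu) sX.
by rewrite -[EM]mul1mx; apply: (Gr_schubert hm hmu (c := 1%:M)); rewrite mulmx1.
Qed.

(** The positions of [la] contain [S2] and avoid [S0], so [b] in [K] stabilizes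
[U_la], and likewise [W_mu]; hence [b (1 + X) U_la = (1 + b X b^-1) b U_la] with
[b U_la = U_la]. *)
Lemma pair_of_conj b c (X : 'M[C]_n) : block_upper S0 S2 b -> b *m c = 1%:M ->
  pair_of (b *m X *m c) = (vs_act b (pair_of X).1, vs_act b (pair_of X).2).
Proof.
move=> [_ blb] bc.
have bl i j : b i j != 0 -> (schubert_pos la j ==> schubert_pos la i)
                         && (schubert_pos mu j ==> schubert_pos mu i).
  have [->|ij bij] := eqVneq i j; first by rewrite !implybb.
  have /orP[/andP[_ /free_posP/andP[]]|/andP[/full_posP/andP[-> ->] _]] :=
    blb i j ij bij; last by rewrite !implybT.
  by move=> /negPf-> /negPf->.
rewrite /pair_of /= !vs_act_colspan; congr (_, _).
  have -> : b *m ((1%:M + X) *m EL) = (1%:M + b *m X *m c) *m (b *m EL).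
    by rewrite !mulmxDl !mul1mx mulmxDr -!mulmxA (mulmxA c) (mulmx1C bc) mul1mx.
  rewrite -[LHS]vs_act_colspan -[RHS]vs_act_colspan; congr (vs_act _ _).
  by apply/esym/(colspan_schubert_act hk hla bc) => i j /bl/andP[/implyP].
by apply/esym/(colspan_schubert_act hm hmu bc) => i j /bl/andP[_ /implyP].
Qed.

Lemma Gr2_closure_act b c UW UW' : upper b -> b *m c = 1%:M ->
  Gr k UW.1 -> Gr m UW.2 ->
  Gr2_closure k m (pair_orbit (R := R) (n := n) UW) UW' ->
  Gr2_closure k m (pair_orbit UW) (vs_act b UW'.1, vs_act b UW'.2).
Proof.
move=> ub bc gU gW h Z [cZ sZ]; have cb := mulmx1C bc.
have [] // : [set V : {vspace 'cV[C]_n} * {vspace 'cV[C]_n} |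
  [/\ Gr k V.1, Gr m V.2 & Z (vs_act b V.1, vs_act b V.2)]] UW'.
apply: h; split; first exact: Gr2_closed_preim cb cZ.
move=> _ [a [au ua] <-] /=; have va := mulVmx au.
split; rewrite ?/(Gr _ _) /= ?(dim_vs_act _ va) //.
rewrite !vs_actM; apply: sZ; exists (b *m a) => //.
by apply: borelM => //; apply: borel_of_inv bc.
Qed.

Lemma pair_orbit_refl UW : pair_orbit (R := R) (n := n) UW UW.
Proof. by exists 1%:M; [exact: borel1|rewrite !vs_act1 -surjective_pairing]. Qed.

Variables (v w : 'S_n).
Hypothesis (hv : v \in box_involutions n la mu).
Hypothesis (hw : w \in box_involutions n la mu).

Let shape u : u \in box_involutions n la mu -> in_shape S0 S2 (inv_lt R u).
Proof. by move=> hu; rewrite inv_ltE; apply/rook_shape/arc_rooks. Qed.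

(** The incidence rank of a pair drops or stays under the action of [B], so the
closed set where it is at most its value at the representative of [w] contains
the orbit of [w]. *)
Lemma Gr_le_count :
  O_orbit R la mu v `<=` Gr2_closure k m (O_orbit R la mu w) ->
  forall i j, (rook_count (arc v) i j <= rook_count (arc w) i j)%N.
Proof.
rewrite !O_orbitE // => vw; apply: (@arc_count_le _ _ _ _ _ R _ _ hv hw) => i j jn.
have [gA gB] := Gr_pair_of (shape hw).
rewrite -(incidence_le_corner i j (shape hv) (shape hw)).
set r := (X in (_ <= X)%N).
have [A [B [_ _ [eA eB] rk]]] : [set UW | exists (A : 'M_(n, k)) (B : 'M_(n, m)),
    [/\ Gr k (colspan A), Gr m (colspan B), UW = (colspan A, colspan B)
      & (\rank (incidence_mx i j A B) <= r)%N]] (pair_of (inv_lt R v)).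
  apply: (vw _ (pair_orbit_refl _)); split; first exact: Gr2_closed_incidence.
  move=> _ [b [bu ub] <-]; have cb := mulVmx bu.
  exists (b *m pair_frame (inv_lt R w)), (b *m EM).
  split; last exact: incidence_upper.
  - by rewrite -vs_act_colspan /Gr /= (dim_vs_act _ cb).
  - by rewrite -vs_act_colspan /Gr /= (dim_vs_act _ cb).
  - by rewrite /= !vs_act_colspan.
by apply: leq_trans rk; apply: incidence_colspan; rewrite (eA, eB).
Qed.

(** Along a line in [N], the frame of the first space is affine in [t] and the
frame of the second is constant; so limits stay in closed sets of pairs. *)
Lemma count_Gr_le :
  (forall i j, rook_count (arc v) i j <= rook_count (arc w) i j)%N ->
  O_orbit R la mu v `<=` Gr2_closure k m (O_orbit R la mu w).
Proof.
rewrite !O_orbitE // => le_vw _ [b [bu ub] <-].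
have [gU gW] := Gr_pair_of (shape hw).
apply: (Gr2_closure_act ub (mulmxV bu) gU gW).
pose Phi X := Gr2_closure k m (pair_orbit (pair_of (inv_lt R w))) (pair_of X).
rewrite (inv_ltE R v) -/(Phi _).
refine (@rook_degeneration R[i] n _ _ (@free_full_pos n k m la mu) Phi
  _ _ (arc w) (arc v) (arc_rooks hw) (arc_rooks hv) le_vw _).
- move=> a c X _ ba ac hX; rewrite /Phi (pair_of_conj _ ba ac).
  by apply: Gr2_closure_act hX => //; [case: ba|exact: ac].
- move=> X Y sX sY h Z [cZ YZ]; have [ZG [P PZ]] := cZ.
  have [gA gB] := Gr_pair_of sX.
  apply/(PZ _ _ gA gB) => p Pp.
  apply: (@meval_line_eq0 _ _ _ _ (pair_point (Y *m EL) 0)) => t t0.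
  have hZ : Z (pair_of (X + t *: Y)) by apply: h.
  have [gA' _] := ZG _ hZ.
  move/(PZ _ _ gA' gB): hZ => /(_ p Pp) <-; apply: meval_eq => i.
  rewrite /pair_frame addrA [in RHS]mulmxDl -scalemxAl /pair_point.
  have -> : row_mx (mxvec ((1%:M + X) *m EL + t *: (Y *m EL))) (mxvec EM)
     = row_mx (mxvec ((1%:M + X) *m EL)) (mxvec EM)
       + t *: row_mx (mxvec (Y *m EL)) (mxvec 0).
    by rewrite scale_row_mx add_row_mx !linear0 ?scaler0 addr0 linearD linearZ.
  by rewrite !mxE.
- by rewrite -inv_ltE => Z [_]; apply; exact: pair_orbit_refl.
Qed.

End DoubleGrassmannian.

Theorem theorem1p1 (R : realType) (n k m : nat)
    (hn : (1 <= n)%N) (hk : (k <= n)%N) (hm : (m <= n)%N)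
    (la : k.-tuple nat) (mu : m.-tuple nat)
    (hla : is_box_partition n la) (hmu : is_box_partition n mu)
    (v w : 'S_n)
    (hv : v \in box_involutions n la mu) (hw : w \in box_involutions n la mu) :
  O_orbit R la mu v `<=` Gr2_closure k m (O_orbit R la mu w) <->
  adj_orbit (inv_lt R v) `<=` nil2_closure (adj_orbit (inv_lt R w)).
Proof.
split.
- by move=> /(Gr_le_count hk hm hla hmu hv hw); exact: (count_adj_le hv hw).
- by move=> /(adj_le_count hv hw); exact: (count_Gr_le hk hm hla hmu hv hw).
Qed.
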